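(* Let $0<\beta<\alpha\le\lceil\alpha\rceil=n\in\mathbb N$, let $a\ge 0$ be a real number, and let $f:[0,\infty)\times\mathbb R\to\mathbb R$ and $g:[0,\infty)\to\mathbb R$ be continuous functions such that: (1) there exists $T>0$ such that $x f(t,x)\le 0$ for all $t\ge T$ and all $x\in\mathbb R$; (2) $$\limsup_{t\to+\infty}t^{\beta-\alpha-n+1}\int_0^t (t-s)^{\alpha-1}g(s)\,ds=+\infty,\qquad \liminf_{t\to+\infty}t^{\beta-\alpha-n+1}\int_0^t (t-s)^{\alpha-1}g(s)\,ds=-\infty.$$ Then for arbitrary initial values $x_0,x_1,\dots,x_{n-1}\in\mathbb R$, any solution $x$ that exists globally on $[0,\infty)$ of $${}^CD^\alpha_{0^+}x(t)+a\,{}^CD^\beta_{0^+}x(t)=f(t,x(t))+g(t),\quad t>0,\qquad x^{(j)}(0)=x_j,\ j=0,1,\dots,n-1,$$ is oscillatory.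
   Context: For $\alpha>0$ and $f:J\to\mathbb R$ with $J=[0,T]$ or $J=[0,\infty)$, the Riemann–Liouville integral is $I^\alpha_{0^+}f(t)=\frac1{\Gamma(\alpha)}\int_0^t(t-s)^{\alpha-1}f(s)\,ds$, and $I^0_{0^+}f=f$. With $n=\lceil\alpha\rceil$, the Caputo derivative of order $\alpha$ is ${}^CD^\alpha_{0^+}f(t)=\frac{d^n}{dt^n}I^{n-\alpha}_{0^+}\big(f-\sum_{k=0}^{n-1}\frac{f^{(k)}(0)}{k!}(\cdot)^k\big)(t)$ for $t\in J\setminus\{0\}$. A function $f\in C^{n-1}(J)$ is continuously Caputo $\alpha$-differentiable on $J$ if ${}^CD^\alpha_{0^+}f$ exists and is continuous on $J$ (value at $0$ by continuous extension). A solution on $[0,\infty)$ of the initial value problem (whose highest order is $\alpha$) is a function $x:[0,\infty)\to\mathbb R$ that is continuously Caputo $\alpha$-differentiable on $[0,\infty)$, satisfies the equation on $(0,\infty)$ and satisfies the initial conditions. A solution $x$ is oscillatory if it exists globally on $[0,\infty)$ and there is a sequence $t_k\in[0,\infty)$ with $t_k\to\infty$ and $x(t_k)=0$ for all $k$. *)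

(* Defs.v *)
From HB Require Import structures.
From mathcomp Require Import all_boot all_order all_algebra.
From mathcomp Require Import all_classical all_reals all_analysis.
Set Implicit Arguments.
Unset Strict Implicit.
Unset Printing Implicit Defensive.
Import Order.TTheory GRing.Theory Num.Theory.
Import numFieldNormedType.Exports.
Local Open Scope classical_set_scope.
Local Open Scope ring_scope.

(* A function on [0, +oo[ is represented by a total function on R; no
   definition below depends on its values at negative arguments. *)

Section FractionalCalculus.
Context {R : realType}.
Implicit Types (f x y : R -> R) (alpha t : R) (n : nat).

(* Difference quotients at t restricted to [0, +oo[, so that the derivative is
   the right-hand one at t = 0 and the usual one at t > 0. *)
Definition half_quotient f t : R -> R := fun h => h^-1 *: (f (h + t) - f t).

Definition half_nbhs t : set_system R := within [set h | 0 <= h + t] 0^'.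

Definition half_derivable f t : Prop :=
  cvg (half_quotient f t h @[h --> half_nbhs t]).

Definition half_deriv f : R -> R :=
  fun t => lim (half_quotient f t h @[h --> half_nbhs t]).

Definition half_derivn n f : R -> R := iter n half_deriv f.

Definition half_C n f : Prop :=
  (forall k t, (k < n)%N -> 0 <= t -> half_derivable (half_derivn k f) t) /\
  (forall k, (k <= n)%N -> {within `[0, +oo[, continuous (half_derivn k f)}).

Definition Gamma alpha : R :=
  (\int[lebesgue_measure]_(s in `]0%R, +oo[) (s `^ (alpha - 1) * expR (- s)))%R.

Definition RLintegral alpha f : R -> R := fun t =>
  if alpha == 0 then f t else
  (Gamma alpha)^-1 *
  (\int[lebesgue_measure]_(s in `[0%R, t]) ((t - s) `^ (alpha - 1) * f s))%R.

Definition order_ceil alpha : nat := `|Num.ceil alpha|%N.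

Definition taylor_remainder n f : R -> R := fun t =>
  f t - \sum_(k < n) half_derivn k f 0 / k`!%:R * t ^+ k.

Definition caputo_primitive alpha f : R -> R :=
  let n := order_ceil alpha in
  RLintegral (n%:R - alpha) (taylor_remainder n f).

(* Only meaningful at t > 0, where the n-th derivative is the two-sided one. *)
Definition caputo alpha f : R -> R :=
  derive1n (order_ceil alpha) (caputo_primitive alpha f).

Definition caputo_exists alpha f : Prop :=
  forall k t, (k < order_ceil alpha)%N -> 0 < t ->
    derivable (derive1n k (caputo_primitive alpha f)) t 1.

(* The last conjunct is the continuous extension of the derivative to 0. *)
Definition continuously_caputo alpha f : Prop :=
  [/\ half_C (order_ceil alpha).-1 f,
      caputo_exists alpha f,
      {within `]0, +oo[, continuous (caputo alpha f)} &
      cvg (caputo alpha f t @[t --> 0^'+])].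

(* Satisfying the equation includes the existence of the derivative of lower
   order beta; that of order alpha is part of continuously_caputo. *)
Definition global_solution (alpha beta a : R) (f : R -> R -> R) (g : R -> R)
    n (xi : 'I_n -> R) x : Prop :=
  [/\ continuously_caputo alpha x,
      caputo_exists beta x,
      (forall t, 0 < t ->
        caputo alpha x t + a * caputo beta x t = f t (x t) + g t) &
      (forall j : 'I_n, half_derivn j x 0 = xi j)].

Definition oscillatory x : Prop :=
  exists u : nat -> R,
    [/\ (forall k, 0 <= u k), u k @[k --> \oo] --> +oo &
        (forall k, x (u k) = 0)].

End FractionalCalculus.

(* Main.v *)
Require Import Defs.
From HB Require Import structures.
From mathcomp Require Import all_boot all_order all_algebra.
From mathcomp Require Import all_classical all_reals all_analysis.
From mathcomp Require Import measurable_realfun ring lra.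
Set Implicit Arguments.
Unset Strict Implicit.
Unset Printing Implicit Defensive.
Import Order.TTheory GRing.Theory Num.Theory.
Import numFieldNormedType.Exports.
Local Open Scope classical_set_scope.
Local Open Scope ring_scope.

(** If [x] has no zero after some time, it keeps a constant sign there, say
    [x > 0]; then [f t (x t) <= 0] for large [t]. Integrating the equation to the
    order [alpha] expresses the fractional integral of [g] as a nonnegative
    combination of [x] and its fractional integral of order [alpha - beta], minus
    the fractional integral of [f t (x t)], plus terms coming from Taylor
    polynomials of [x] at [0]. The values of [x] and [f t (x t)] at large times
    contribute nonnegative terms. What remains, namely the polynomials and the contributions of a bounded
    initial interval, is bounded after multiplication by
    [t `^ (beta - alpha - n + 1)] ([weighted_lbound_solution]). Thus the weighted
    integral of [g] is bounded below, which contradicts the hypothesis on the lower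
    limit. When [x < 0] the same estimate for the opposite functions contradicts
    the hypothesis on the upper limit.

    The integrated equation ([fractional_equation]) needs two facts about
    fractional integrals. The first one is the semigroup law ([fracint_comp]),
    obtained from Tonelli's theorem; only the positivity of its Beta factor is
    used, so every constant is kept implicit. The second one is that the fractional
    integral of the Caputo derivative of [x] is a multiple of [x] minus its Taylor
    polynomial ([caputo_inversion]). For a derivative of order [a], with [n] the
    least integer not below [a], the fractional integral of order [n - a] of the
    Taylor remainder and the [n]-fold primitive of the derivative have the same
    [n]-th derivative, so they differ by a polynomial of degree less than [n]; both
    are [o(t ^ (n - 1))] at [0], so they are equal. The semigroup law and the
    injectivity of iterated primitives then give the claim. *)

(** * Affine substitutions and the truncated power *)

Section Kernel.
Context {R : realType}.
Notation mu := (@lebesgue_measure R).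
Implicit Types (a b c t x : R).

Definition affine c b (x : measurableTypeR R) : measurableTypeR R := c * x + b.

Lemma measurable_affine c b : measurable_fun setT (affine c b).
Proof. by apply: measurable_funD => //; exact: measurable_funM. Qed.

(** Both sides are measures, so it is enough to compare them on half-open
    intervals. *)
Lemma lebesgue_measure_affine c b (A : set R) : 0 < c -> measurable A ->
  (mu A = c%:E * pushforward mu (affine c b) A)%E.
Proof.
move=> c0; pose phi_mu : {measure set measurableTypeR R -> \bar R} :=
  measure_function_pushforward__canonical__measure_function_Measure
    mu (measurable_affine c b).
apply: (lebesgue_measure_unique (mu := mscale (NngNum (ltW c0)) phi_mu)).
move=> _ [[u v]] _ <-.
transitivity (c%:E * mu `]((u - b) / c)%R, ((v - b) / c)%R]%classic)%E; last first.
  congr (_ * mu _)%E; apply/seteqP; split => x /=;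
    rewrite /affine !in_itv/= ltr_pdivrMr// ler_pdivlMr// ltrBlDr lerBrDr mulrC //.
rewrite /= !lebesgue_measure_itv/= !lte_fin ltr_pM2r ?invr_gt0//.
rewrite ltrD2r; case: ifPn => uv; last by rewrite mule0.
rewrite -!EFinB -EFinM -mulrBl mulrCA divff ?mulr1 ?gt_eqF//.
by congr (_%:E); ring.
Qed.

Lemma ge0_integral_affine c b (f : R -> \bar R) : 0 < c ->
  measurable_fun [set: R] f -> (forall x, 0 <= f x)%E ->
  (\int[mu]_x f x = c%:E * \int[mu]_x f (c * x + b)%R)%E.
Proof.
move=> c0 mf f0; have mphi := measurable_affine c b.
have := @ge0_integral_pushforward _ _ _ _ _ _ mphi mu setT f measurableT mf.
rewrite preimage_setT /= => <- //.
have -> : c%:E = (NngNum (ltW c0))%:num%:E by [].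
rewrite -ge0_integral_mscale//.
apply: eq_measure_integral => //= A mA _.
exact: lebesgue_measure_affine.
Qed.

(** The infinite cases cannot be excluded here, but a positive factor commutes
    with the difference of any two extended reals. *)
Lemma integral_affine c b (f : R -> \bar R) : 0 < c ->
  measurable_fun [set: R] f ->
  (\int[mu]_x f x = c%:E * \int[mu]_x f (c * x + b)%R)%E.
Proof.
move=> c0 mf; rewrite integralE.
rewrite (@ge0_integral_affine c b (funepos f))//; last exact: measurable_funepos.
rewrite (@ge0_integral_affine c b (funeneg f))//; last exact: measurable_funeneg.
rewrite [in RHS]integralE.
have distr (A B : \bar R) : (c%:E * A - c%:E * B = c%:E * (A - B))%E.
  have c0' : (0 < c%:E)%E by rewrite lte_fin.
  case: A => [r| |]; case: B => [s| |];
    rewrite ?(gt0_muley, gt0_muleNy)//= ?(gt0_muley, gt0_muleNy)//.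
  by congr (_%:E); rewrite mulrBr.
by rewrite distr; congr (_ * (_ - _))%E; apply: eq_integral => x _;
  rewrite ?funeposE ?funenegE.
Qed.

(** Truncating the power at [0] turns the fractional integral over [[0, t]] into
    a convolution on the whole line, to which Tonelli's theorem applies
    directly. *)
Definition ker a t : R := if 0 < t then t `^ (a - 1) else 0.

Lemma ker_ge0 a t : 0 <= ker a t.
Proof. by rewrite /ker; case: ifP => // _; exact: powR_ge0. Qed.

Lemma ker_scale a c t : 0 < c -> ker a (c * t) = c `^ (a - 1) * ker a t.
Proof.
move=> c0; rewrite /ker pmulr_rgt0//; case: ifP => [t0|]; last by rewrite mulr0.
by rewrite powRM// ltW.
Qed.

Lemma measurable_ker a : measurable_fun [set: R] (ker a).
Proof.
apply: measurable_fun_if => //; first exact: measurable_fun_ltr.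
by apply: measurable_funTS; exact: measurable_powR.
Qed.

Lemma integral_reflect b (f : R -> \bar R) :
  measurable_fun [set: R] f -> (forall x, 0 <= f x)%E ->
  (\int[mu]_x f x = \int[mu]_x f (b - x)%R)%E.
Proof.
move=> mf f0.
rewrite (@ge0_integral_affine 1 b)// mul1e.
have mN : measurable_fun [set: measurableTypeR R] (-%R : R -> measurableTypeR R).
  exact: oppr_measurable.
have mg : measurable_fun [set: measurableTypeR R] (fun x : R => f (1 * x + b)).
  exact: (measurableT_comp mf (measurable_affine 1 b)).
have := @ge0_integral_pushforward _ _ _ _ _ _ mN mu setT _ measurableT mg.
rewrite preimage_setT /= => E.
transitivity (\int[mu]_x f (1 * - x + b)%R)%E; last first.
  by apply: eq_integral => x _; rewrite mul1r addrC.
rewrite -E; last by [].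
by apply: eq_measure_integral => A mA _; exact/esym/lebesgue_measureN.
Qed.

(** A power function is monotone, but in which direction depends on the sign of
    the exponent; the sum of the two end values covers both cases. *)
Lemma powR_le_ends (p q v e : R) : 0 < p -> p <= v -> v <= q ->
  v `^ e <= p `^ e + q `^ e.
Proof.
move=> p0 pv vq; have v0 : 0 < v := lt_le_trans p0 pv.
have [e0|e0] := leP 0 e.
  apply: (@le_trans _ _ (q `^ e)); last by rewrite lerDr powR_ge0.
  by rewrite ge0_ler_powR// nnegrE; apply/ltW => //; exact: lt_le_trans vq.
apply: (@le_trans _ _ (p `^ e)); last by rewrite lerDl powR_ge0.
have E x : x `^ e = (x `^ (- e))^-1 by rewrite -powRN opprK.
rewrite (E v) (E p) lef_pV2 ?posrE ?powR_gt0//.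
by rewrite ge0_ler_powR// ?nnegrE ?oppr_ge0 ltW.
Qed.

Lemma integral_powR_le a (e : R) : 0 < a -> 0 < e < 1 ->
  (\int[mu]_(x in `[e, 1%R]) (x `^ (a - 1))%:E <= (a^-1)%:E)%E.
Proof.
move=> a0 /andP[e0 e1].
have dF (x : R) : 0 < x -> is_derive x 1 (fun x : R => a^-1 * x `^ a) (x `^ (a - 1)).
  move=> x0; have := is_deriveZ a^-1 (is_derive1_powR a x0).
  by rewrite /GRing.scale/= mulrA mulVf ?mul1r// gt_eqF.
have cF (x : R) : 0 < x -> {for x, continuous (fun x : R => a^-1 * x `^ a)}.
  move=> x0; apply: differentiable_continuous; apply/derivable1_diffP.
  by have [] := dF _ x0.
have cf (x : R) : 0 < x -> {for x, continuous (fun x : R => x `^ (a - 1))}.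
  move=> x0; apply: differentiable_continuous; apply/derivable1_diffP.
  by apply: derivable_powR; rewrite in_itv/= x0.
rewrite (@continuous_FTC2 _ _ (fun x => a^-1 * x `^ a))//.
- by rewrite -EFinB lee_fin powR1 mulr1 lerBlDr lerDl mulr_ge0// ?powR_ge0// invr_ge0 ltW.
- apply: continuous_in_subspaceT => x; rewrite inE/= in_itv/= => /andP[ex _].
  by apply: cf; exact: lt_le_trans ex.
- split.
  + move=> x; rewrite in_itv/= => /andP[ex _].
    by have [] := dF _ (lt_trans e0 ex).
  + by apply: cvg_at_right_filter; exact: cF.
  + by apply: cvg_at_left_filter; exact: cF.
- move=> x; rewrite in_itv/= => /andP[ex _].
  by rewrite derive1E; have [_ <-] := dF _ (lt_trans e0 ex).
Qed.

(** For an order below [1] the kernel is unbounded at [0], so the fundamental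
    theorem of calculus is applied on [[1 / (n + 2), 1]] and the bound passes to
    the limit by monotone convergence. *)
Lemma integral_ker01_lty a : 0 < a ->
  (\int[mu]_(x in `[0%R, 1%R]) (ker a x)%:E < +oo)%E.
Proof.
move=> a0.
rewrite -integral_itv_obnd_cbnd; last first.
  by apply/measurable_EFinP; apply: measurable_funTS; exact: measurable_ker.
pose F (n : nat) : set (measurableTypeR R) := `[n.+2%:R^-1, 1]%classic.
have -> : `]0, 1]%classic = \bigcup_n F n.
  apply/seteqP; split => x /=.
    rewrite in_itv/= => /andP[x0 x1].
    exists (Num.truncn x^-1) => //; rewrite /F/= in_itv/= x1 andbT.
    rewrite invf_ple ?posrE//.
    by rewrite (le_trans (ltW (truncnS_gt _)))// ler_nat.
  move=> [n _]; rewrite /F/= !in_itv/= => /andP[nx ->]; rewrite andbT.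
  exact: lt_le_trans nx.
apply: (@le_lt_trans _ _ (a^-1)%:E); last exact: ltry.
have cvgF := @ge0_nondecreasing_set_cvg_integral _ _ _ F (EFin \o ker a) mu.
apply: (cvge_to_le (cvgF _ _ _ _)).
- move=> n m nm; rewrite subsetEset => x; rewrite /F/= !in_itv/= => /andP[nx ->].
  by rewrite andbT (le_trans _ nx)// lef_pV2 ?posrE// ler_nat !ltnS.
- by move=> n; exact: measurable_itv.
- move=> n; apply/measurable_EFinP; apply: measurable_funTS.
  exact: measurable_ker.
- by move=> n x _; rewrite lee_fin ker_ge0.
- apply: nearW => n; rewrite /F.
  rewrite (_ : integral _ _ _ =
      (\int[mu]_(x in `[n.+2%:R^-1%R, 1%R]) (x `^ (a - 1))%:E)%E).
    by apply: integral_powR_le => //; rewrite invr_gt0 ltr0n/= invf_lt1// ltr1n.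
  apply: eq_integral => x; rewrite inE/= in_itv/= => /andP[nx _].
  by rewrite /ker (lt_le_trans _ nx)// invr_gt0.
Qed.

End Kernel.

(** * Fractional integrals of continuous functions *)

Section Convolution.
Context {R : realType}.
Notation mu := (@lebesgue_measure R).
Implicit Types (a b c t x : R) (f g : R -> R).

Lemma measurable_ker_sub a t : measurable_fun [set: R] (fun s => ker a (t - s)).
Proof.
apply: (measurableT_comp (measurable_ker a)).
by apply: measurable_funB => //; exact: measurable_cst.
Qed.

Lemma integral_ker_sub a t : 0 < a -> 0 < t ->
  (\int[mu]_(s in `[0%R, t]) (ker a (t - s))%:E =
   (t `^ a)%:E * \int[mu]_(u in `[0%R, 1%R]) (ker a u)%:E)%E.
Proof.
move=> a0 t0; rewrite integral_mkcond.
have mD : measurable_fun [set: R] ((EFin \o ker a) \_ `[0, t]).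
  apply/(measurable_restrictT _ _).1 => //; apply: measurable_funTS.
  by apply/measurable_EFinP; exact: measurable_ker.
transitivity (\int[mu]_s ((EFin \o ker a) \_ `[0%R, t]) s)%E.
  rewrite [RHS](@integral_reflect _ t)//; last first.
    by move=> x; rewrite patchE; case: ifP => // _; rewrite lee_fin ker_ge0.
  apply: eq_integral => s _; rewrite !patchE; congr (if _ then _ else _).
  by apply/idP/idP; rewrite !inE/= !in_itv/= => /andP[? ?]; apply/andP; split; lra.
rewrite (@ge0_integral_affine _ t 0)//; last first.
  by move=> x; rewrite patchE; case: ifP => // _; rewrite lee_fin ker_ge0.
rewrite -(mulr_powRB1 (ltW t0) a0) EFinM -muleA; congr (_ * _)%E.
rewrite -ge0_integralZl//; last 3 first.
- by apply/measurable_EFinP; apply: measurable_funTS; exact: measurable_ker.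
- by move=> x _; rewrite lee_fin ker_ge0.
- by rewrite lee_fin powR_ge0.
rewrite [RHS]integral_mkcond; apply: eq_integral => u _.
rewrite !patchE addr0 /= ker_scale//; congr (if _ then _ else _).
apply/idP/idP; rewrite !inE/= !in_itv/= pmulr_rge0// => /andP[-> u1] /=;
  by move: u1; rewrite -{2}[t]mulr1 ler_pM2l.
Qed.

Lemma integrable_ker_sub a t : 0 < a ->
  mu.-integrable `[0, t] (fun s => (ker a (t - s))%:E).
Proof.
move=> a0; apply/integrableP; split.
  by apply/measurable_EFinP; apply: measurable_funTS; exact: measurable_ker_sub.
under eq_integral do rewrite gee0_abs ?lee_fin ?ker_ge0//.
have [t0|t0] := ltP 0 t.
  rewrite integral_ker_sub//; apply: lte_mul_pinfty; first by rewrite lee_fin powR_ge0.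
    by [].
  exact: integral_ker01_lty.
rewrite integral0_eq// => s; rewrite /= in_itv/= => /andP[s0 _].
by rewrite /ker ifF//; apply/negbTE; rewrite -leNgt; lra.
Qed.

Lemma continuous_bounded_itv f (p q : R) : continuous f ->
  exists2 M : R, 0 <= M & forall x, p <= x <= q -> `|f x| <= M.
Proof.
move=> cf; have [pq|pq] := leP p q; last first.
  by exists 0 => // x /andP[px xq]; exfalso; move: (le_trans px xq); rewrite leNgt pq.
have cnf : {within `[p, q], continuous (fun x => `|f x|)}.
  apply: continuous_subspaceT => x.
  by apply: continuous_comp; [exact: cf|exact: norm_continuous].
have [c _ fc] := EVT_max pq cnf.
by exists `|f c| => // x xpq; apply: fc; rewrite in_itv.
Qed.

(** The kernel is integrable on [[0, t]] and a continuous factor is bounded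
    there. *)
Lemma integrable_ker_sub_mul a t f : 0 < a -> continuous f ->
  mu.-integrable `[0, t] (EFin \o (fun s => ker a (t - s) * f s)).
Proof.
move=> a0 cf.
suff : mu.-integrable `[0, t] ((fun s => (ker a (t - s))%:E) \* (EFin \o f))%E by [].
apply: integrableMl => //.
- exact: integrable_ker_sub.
- by apply: measurable_funTS; exact: continuous_measurable_fun.
- have [M M0 fM] := continuous_bounded_itv 0 t cf.
  exists M; split; first exact: num_real.
  move=> N MN s; rewrite /= in_itv/= => st.
  by apply: le_trans (ltW MN); exact: fM.
Qed.

(** The Riemann-Liouville integral of order [a] without its Gamma factor. All the
    arguments below use the normalising constants only through their sign, so
    they are left out and compositions hold up to positive factors. *)
Definition fracint a f t : R := \int[mu]_(s in `[0, t]) (ker a (t - s) * f s).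

(** The two integrands differ at [s = t] only: when [a = 1] the power of [0] is
    [1] whereas the kernel vanishes. *)
Lemma fracintE a f t : continuous f ->
  \int[mu]_(s in `[0, t]) ((t - s) `^ (a - 1) * f s) = fracint a f t.
Proof.
move=> cf; have mf := continuous_measurable_fun cf.
rewrite /fracint /Rintegral -integral_itv_bndo_bndc; last first.
  apply/measurable_EFinP; apply: measurable_funTS; apply: measurable_funM => //.
  apply: (measurableT_comp (@measurable_powR R (a - 1))).
  by apply: measurable_funB => //; exact: measurable_cst.
rewrite -[in RHS]integral_itv_bndo_bndc; last first.
  apply/measurable_EFinP; apply: measurable_funTS.
  by apply: measurable_funM => //; exact: measurable_ker_sub.
congr fine; apply: eq_integral => s; rewrite inE/= in_itv/= => /andP[_ st].
by rewrite /ker subr_gt0 st.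
Qed.

Lemma fracint_le0 a f t : t <= 0 -> fracint a f t = 0.
Proof.
move=> t0; rewrite /fracint /Rintegral integral0_eq// => s; rewrite /= in_itv/= => /andP[s0 _].
by rewrite /ker ifF ?mul0r//; apply/negbTE; rewrite -leNgt; lra.
Qed.

Lemma eq_fracint a f g t : (forall s, 0 <= s <= t -> f s = g s) ->
  fracint a f t = fracint a g t.
Proof.
move=> fg; apply: eq_Rintegral => s; rewrite inE/= in_itv/= => st.
by rewrite fg.
Qed.

Section linearity.
Variables (a t : R) (a0 : 0 < a).

Lemma fracintD f g : continuous f -> continuous g ->
  fracint a (fun s => f s + g s) t = fracint a f t + fracint a g t.
Proof.
move=> cf cg; rewrite /fracint -RintegralD//; try exact: integrable_ker_sub_mul.
by apply: eq_Rintegral => s _; rewrite mulrDr.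
Qed.

Lemma fracintZ k f : continuous f -> fracint a (fun s => k * f s) t = k * fracint a f t.
Proof.
move=> cf; rewrite /fracint -RintegralZl//; last exact: integrable_ker_sub_mul.
by apply: eq_Rintegral => s _; rewrite mulrCA.
Qed.

Lemma fracintN f : continuous f -> fracint a (fun s => - f s) t = - fracint a f t.
Proof.
move=> cf; rewrite -mulN1r -fracintZ//.
by apply: eq_fracint => s _; rewrite mulN1r.
Qed.

Lemma le_fracint f g : continuous f -> continuous g ->
  (forall s, 0 <= s <= t -> f s <= g s) -> fracint a f t <= fracint a g t.
Proof.
move=> cf cg fg; apply: le_Rintegral => //; try exact: integrable_ker_sub_mul.
move=> s; rewrite /= in_itv/= => st.
by apply: ler_wpM2l; [exact: ker_ge0|exact: fg].
Qed.

Lemma fracint_ge0 f : (forall s, 0 <= s <= t -> 0 <= f s) -> 0 <= fracint a f t.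
Proof.
move=> f0; apply: Rintegral_ge0 => s; rewrite /= in_itv/= => st.
by rewrite mulr_ge0 ?ker_ge0 ?f0.
Qed.

End linearity.

Lemma Rintegral_affine c b f : 0 < c -> measurable_fun [set: R] f ->
  \int[mu]_x f x = c * \int[mu]_x f (c * x + b).
Proof.
move=> c0 mf; rewrite /Rintegral (@integral_affine _ c b)//; last exact/measurable_EFinP.
have c0' : (0 < c%:E)%E by rewrite lte_fin.
by case: (integral _ _ _) => [r| |]; rewrite ?(gt0_muley, gt0_muleNy)//= mulr0.
Qed.

(** The substitution [s = t * u] moves the variable [t] out of the singular
    kernel, which gives both the growth and the continuity of fractional
    integrals. *)
Lemma fracint_rescale a f t : 0 < a -> 0 < t -> continuous f ->
  fracint a f t = t `^ a * fracint a (fun u => f (t * u)) 1.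
Proof.
move=> a0 t0 cf; rewrite /fracint Rintegral_mkcond.
have cft : continuous (fun u => f (t * u)).
  by move=> u; apply: continuous_comp; [exact: mulrl_continuous|exact: cf].
rewrite (Rintegral_affine 0 t0); last first.
  apply/(measurable_restrictT _ _).1 => //; apply: measurable_funTS.
  apply: measurable_funM; first exact: measurable_ker_sub.
  exact: continuous_measurable_fun.
rewrite -(mulr_powRB1 (ltW t0) a0) -mulrA; congr (_ * _).
rewrite -RintegralZl//; last exact: integrable_ker_sub_mul.
rewrite [RHS]Rintegral_mkcond; apply: eq_Rintegral => u _.
rewrite !patchE addr0 /= mulrA -ker_scale// mulrBr mulr1.
congr (if _ then _ else _).
apply/idP/idP; rewrite !inE/= !in_itv/= pmulr_rge0// => /andP[-> u1] /=;
  by move: u1; rewrite -{2}[t]mulr1 ler_pM2l.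
Qed.

Lemma fracint1_rescale a t : 0 < a -> 0 <= t ->
  fracint a (fun=> 1) t = t `^ a * fracint a (fun=> 1) 1.
Proof.
move=> a0; rewrite le_eqVlt => /predU1P[<-|t0].
  by rewrite fracint_le0// powR0 ?mul0r// gt_eqF.
by rewrite fracint_rescale//; exact: cst_continuous.
Qed.

Lemma normr_fracint_le a f t M : 0 < a -> 0 <= t -> continuous f ->
  (forall s, 0 <= s <= t -> `|f s| <= M) ->
  `|fracint a f t| <= M * (t `^ a * fracint a (fun=> 1) 1).
Proof.
move=> a0 t0 cf fM; rewrite -fracint1_rescale// -fracintZ//; last exact: cst_continuous.
have cM (k : R) : continuous (fun _ : R => k * 1) by exact: cst_continuous.
rewrite ler_norml -fracintN//; apply/andP; split; apply: le_fracint => //.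
- by move=> s; exact: cvg_cst.
- by move=> s /fM; rewrite mulr1 ler_norml => /andP[].
- by move=> s /fM; rewrite mulr1 ler_norml => /andP[].
Qed.

(** The clamp at [0] matters because the power of a negative number is [1] by
    convention. *)
Lemma continuous_max0_powR a : 0 < a -> continuous (fun t : R => Num.max 0 t `^ a).
Proof.
move=> a0 t; have [t0|t0|<-] := ltgtP 0 t.
- have ct : {for t, continuous (fun t : R => t `^ a)}.
    apply: differentiable_continuous; apply/derivable1_diffP.
    by apply: derivable_powR; rewrite in_itv/= t0.
  rewrite /continuous_at (max_idPr (ltW t0)); apply: cvg_trans ct.
  apply: near_eq_cvg; near=> s; rewrite (max_idPr _)//.
  by apply: ltW; near: s; exact: lt_nbhsr.
- rewrite /continuous_at (max_idPl (ltW t0)) powR0 ?gt_eqF//.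
  apply: cvg_near_cst; near=> s; rewrite (max_idPl _) ?powR0 ?gt_eqF//.
  by apply: ltW; near: s; exact: lt_nbhsl.
- rewrite /continuous_at ?maxxx powR0 ?gt_eqF//; apply/cvgrPdist_lt => e e0.
  have /cvgrPdist_lt/(_ _ e0) [d /= d0 H] := powR_cvg0 a0.
  exists d => //= s sd; have [s0|s0] := ltP 0 s; first exact: H.
  by rewrite powR0 ?gt_eqF// subrr normr0.
Unshelve. all: by end_near. Qed.

(** A form of the substitution valid for every [t], so that continuity needs no
    case analysis. *)
Lemma fracint_maxE a f t : 0 < a -> continuous f ->
  fracint a f t = Num.max 0 t `^ a * fracint a (fun u => f (t * u)) 1.
Proof.
move=> a0 cf; have [t0|t0] := ltP 0 t; first by rewrite fracint_rescale.
by rewrite fracint_le0// powR0 ?mul0r// gt_eqF.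
Qed.

(** After the substitution the integrand is continuous in [t] and dominated, for
    [t] in a bounded interval, by a multiple of the kernel. *)
Lemma continuous_fracint a f : 0 < a -> continuous f -> continuous (fracint a f).
Proof.
move=> a0 cf t.
have -> : fracint a f = fun t => Num.max 0 t `^ a * fracint a (fun u => f (t * u)) 1.
  by apply/funext => s; exact: fracint_maxE.
apply: cvgM; first exact: continuous_max0_powR.
pose N := `|t| + 1.
have [M M0 fM] := continuous_bounded_itv (- N) N cf.
have N0 : 0 < N by rewrite ltr_wpDl.
have cfx (x : R) : continuous (fun u => f (x * u)).
  by move=> u; apply: continuous_comp; [exact: mulrl_continuous|exact: cf].
apply: (@continuity_under_integral R _ _ mu (fun x u => ker a (1 - u) * f (x * u))
   `[0, 1] _ (- N) N _ _ (fun u => M * ker a (1 - u))) => //.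
- by move=> x _; exact: integrable_ker_sub_mul.
- apply: aeW => u _ x _.
  apply: cvgM; first exact: cvg_cst.
  by apply: continuous_comp; [exact: mulrr_continuous|exact: cf].
- apply: (@eq_integrable _ _ _ mu _ _ (EFin \o (fun u => ker a (1 - u) * M))) => //.
    by move=> u _ /=; rewrite mulrC.
  by apply: integrable_ker_sub_mul => //; exact: cst_continuous.
- move=> x; rewrite /= in_itv/= => /andP[Nx xN].
  apply: aeW => u; rewrite /= in_itv/= => /andP[u0 u1].
  rewrite normrM (ger0_norm (ker_ge0 _ _)) mulrC ler_wpM2r ?ker_ge0//.
  apply: fM; rewrite -ler_norml normrM (ger0_norm u0).
  by rewrite -[leRHS]mulr1 ler_pM// ler_norml !ltW.
- rewrite inE/= in_itv/=.
  by rewrite -ltr_norml /N ltrDl.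
Qed.

End Convolution.

(** * Convolution of kernels *)

Section Semigroup.
Context {R : realType}.
Notation mu := (@lebesgue_measure R).
Implicit Types (a b c t x : R) (f g : R -> R).

Lemma is_derive_fracint1 f t : continuous f -> 0 < t -> is_derive t 1 (fracint 1 f) (f t).
Proof.
move=> cf t0.
have E : fracint 1 f = fun x => (\int[mu]_(s in `[0, x]) f s).
  apply/funext => x; rewrite -fracintE//; apply: eq_Rintegral => s _.
  by rewrite subrr powRr0 mul1r.
have [] := @continuous_FTC1_closed R f 0 t (t + 1) _ _ t0 (cf t).
- by rewrite ltrDl.
- apply: continuous_compact_integrable; first exact: segment_compact.
  exact: continuous_subspaceT.
- by rewrite -E => dJ; rewrite derive1E => dfE; rewrite -dfE; exact: DeriveDef.
Qed.

(** The integral is finite because the integrand is at most the kernel on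
    [0 < x <= 1] and at most the exponential beyond; it is positive because the
    integrand is at least [exp (-1)] on [0 < x <= 1]. *)
Lemma Gamma_gt0 a : 0 < a <= 1 -> 0 < Gamma a.
Proof.
move=> /andP[a0 a1].
pose h (x : R) := x `^ (a - 1) * expR (- x).
have h0 x : 0 <= h x by rewrite mulr_ge0 ?powR_ge0 ?expR_ge0.
have mh : measurable_fun [set: R] h.
  apply: measurable_funM; first exact: measurable_powR.
  by apply: measurableT_comp => //; exact: oppr_measurable.
have mh' D : measurable_fun D (EFin \o h).
  by apply/measurable_EFinP; exact: measurable_funTS.
have mE : measurable_fun [set: R] (fun x : R => (exponential_pdf 1 x)%:E).
  by apply/measurable_EFinP; exact: measurable_exponential_pdf.
have split_int : (\int[mu]_(x in `]0%R, +oo[) (h x)%:E =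
    \int[mu]_(x in `]0%R, 1%R]) (h x)%:E + \int[mu]_(x in `]1%R, +oo[) (h x)%:E)%E.
  rewrite -ge0_integral_setU//=.
  - by rewrite -itv_bndbnd_setU// bnd_simp.
  - exact: mh'.
  - by move=> x _; rewrite lee_fin.
  - apply/disj_setPS => x; rewrite /= !in_itv/= => -[/andP[_ x1]] /andP[+ _].
    by rewrite ltNge x1.
have fin1 : (\int[mu]_(x in `]0%R, 1%R]) (h x)%:E < +oo)%E.
  apply: le_lt_trans (integral_ker01_lty a0).
  rewrite -integral_itv_obnd_cbnd; last first.
    by apply/measurable_EFinP; apply: measurable_funTS; exact: measurable_ker.
  apply: ge0_le_integral => //=.
  - by move=> x _; rewrite lee_fin.
  - exact: mh'.
  - by apply/measurable_EFinP; apply: measurable_funTS; exact: measurable_ker.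
  - move=> x; rewrite in_itv/= => /andP[x0 _].
    rewrite lee_fin /ker x0 /h ler_piMr ?powR_ge0//.
    by rewrite -expR0 ler_expR oppr_le0 ltW.
have fin2 : (\int[mu]_(x in `]1%R, +oo[) (h x)%:E < +oo)%E.
  apply: (@le_lt_trans _ _ (\int[mu]_(x in `]1%R, +oo[) (exponential_pdf 1 x)%:E)%E).
    apply: ge0_le_integral => //=.
    - by move=> x _; rewrite lee_fin.
    - exact: mh'.
    - by apply: measurable_funTS; exact: mE.
    - move=> x; rewrite in_itv/= andbT => x1; rewrite lee_fin /exponential_pdf patchE.
      rewrite ifT ?inE/= ?in_itv/= ?andbT ?(ltW (lt_trans ltr01 x1))//.
      rewrite mul1r mulN1r /h ler_piMl ?expR_ge0//.
      by rewrite -[leRHS](powRr0 x) ler_powR ?(ltW x1)// subr_le0.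
  apply: le_lt_trans (ge0_subset_integral _ _ _ _ _ (@subsetT _ _)) _ => //.
  - by move=> x _; rewrite lee_fin exponential_pdf_ge0.
  - by rewrite integral_exponential_pdf// ltry.
have lb : ((expR (-1))%:E <= \int[mu]_(x in `]0%R, 1%R]) (h x)%:E)%E.
  apply: (@le_trans _ _ (\int[mu]_(x in `]0%R, 1%R]) (expR (-1))%:E)%E).
    by rewrite integral_cst//= lebesgue_measure_itv/= lte_fin ltr01 -EFinB subr0 mule1.
  apply: ge0_le_integral => //=.
  - exact: mh'.
  - move=> x; rewrite in_itv/= => /andP[x0 x1].
    rewrite lee_fin /h -[leLHS]mul1r ler_pM ?expR_ge0// ?ler_expR ?lerN2//.
    by rewrite -[leLHS](powRr0 x) ger_powR ?x0//= subr_le0.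
have e0 : (0 < (expR (-1 : R))%:E)%E by rewrite lte_fin expR_gt0.
rewrite /Gamma /Rintegral; apply: fine_gt0; apply/andP; split.
  rewrite split_int; apply: (lt_le_trans e0); apply: (le_trans lb).
  by rewrite leeDl// integral_ge0// => x _; rewrite lee_fin.
by rewrite split_int lte_add_pinfty.
Qed.

(** Euler's Beta integral; the supports of the kernels restrict it to the unit
    interval. *)
Definition beta_int a b : \bar R := (\int[mu]_u (ker a (1 - u) * ker b u)%:E)%E.

Lemma measurable_ker_conv a b r t :
  measurable_fun [set: R] (fun s => ker a (t - s) * ker b (s - r)).
Proof.
apply: measurable_funM; first exact: measurable_ker_sub.
apply: (measurableT_comp (measurable_ker b)).
by apply: measurable_funB => //; exact: measurable_cst.
Qed.

(** The substitution [s = (t - r) * u + r] maps the overlap of the two kernels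
    onto the unit interval and leaves a Beta integral. *)
Lemma ker_conv_ker a b r t :
  (\int[mu]_s (ker a (t - s) * ker b (s - r))%:E
   = beta_int a b * (ker (a + b) (t - r))%:E)%E.
Proof.
have [rt|tr] := ltP r t; last first.
  rewrite [in RHS]/ker ifF ?mule0; last by apply/negbTE; rewrite -leNgt subr_le0.
  apply: integral0_eq => s _; congr EFin.
  rewrite /ker !subr_gt0; case: ltP => [st|]; last by rewrite mul0r.
  by rewrite ifF ?mulr0//; apply/negbTE; rewrite -leNgt (le_trans (ltW st)).
have c0 : 0 < t - r by rewrite subr_gt0.
rewrite (@ge0_integral_affine _ (t - r) r)//; last 2 first.
- by apply/measurable_EFinP; exact: measurable_ker_conv.
- by move=> s; rewrite lee_fin mulr_ge0 ?ker_ge0.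
pose k := (t - r) `^ (a - 1) * (t - r) `^ (b - 1).
transitivity ((t - r)%:E * \int[mu]_u (k%:E * (ker a (1 - u) * ker b u)%:E))%E.
  congr (_ * _)%E; apply: eq_integral => u _; rewrite -EFinM; congr EFin.
  rewrite (_ : t - _ = (t - r) * (1 - u)); last by ring.
  by rewrite addrK !ker_scale// /k mulrACA.
rewrite ge0_integralZl//; last 3 first.
- by apply/measurable_EFinP; have := measurable_ker_conv a b 0 1;
    under eq_fun do rewrite subr0.
- by move=> u _; rewrite lee_fin mulr_ge0 ?ker_ge0.
- by rewrite lee_fin mulr_ge0 ?powR_ge0.
rewrite muleA muleC -/(beta_int a b) -EFinM; congr (_ * (_)%:E)%E.
have nz : t - r != 0 by rewrite gt_eqF.
rewrite /ker c0 /k -{1}(powRr1 (ltW c0)) -!powRD ?nz ?implybT//.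
by congr (_ `^ _); ring.
Qed.

(** Tonelli's theorem exchanges the integrals, and the inner one is then the
    convolution of two kernels. *)
Lemma conv_ker_conv_ker a b t (phi : R -> R) :
  measurable_fun [set: R] phi -> (forall x, 0 <= phi x) ->
  (\int[mu]_s ((ker a (t - s))%:E * \int[mu]_r (ker b (s - r) * phi r)%:E)
   = beta_int a b * \int[mu]_r (ker (a + b) (t - r) * phi r)%:E)%E.
Proof.
move=> mphi phi0.
have mk1 : measurable_fun [set: R * R] (fun z => ker a (t - z.1)).
  by apply: (measurableT_comp (measurable_ker_sub a t)).
have mk2 : measurable_fun [set: R * R] (fun z => ker b (z.1 - z.2)).
  apply: (measurableT_comp (measurable_ker b)).
  exact: measurable_funB.
have mp : measurable_fun [set: R * R] (fun z => phi z.2).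
  exact: (measurableT_comp mphi).
pose F (z : R * R) := (ker a (t - z.1) * (ker b (z.1 - z.2) * phi z.2))%:E.
have mF : measurable_fun setT F.
  by apply/measurable_EFinP; do 2 (apply: measurable_funM => //).
have F0 z : (0 <= F z)%E by rewrite lee_fin !mulr_ge0 ?ker_ge0.
transitivity (\int[mu]_s \int[mu]_r F (s, r))%E.
  apply: eq_integral => s _; rewrite -ge0_integralZl//.
  - apply/measurable_EFinP; apply: measurable_funM => //.
    by have := measurable_ker_sub b s.
  - by move=> r _; rewrite lee_fin mulr_ge0 ?ker_ge0.
  - by rewrite lee_fin ker_ge0.
rewrite (@fubini_tonelli _ _ _ _ _ mu mu F mF F0).
rewrite -ge0_integralZl//; last 3 first.
- by apply/measurable_EFinP; apply: measurable_funM => //; exact: measurable_ker_sub.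
- by move=> r _; rewrite lee_fin mulr_ge0 ?ker_ge0.
- by apply: integral_ge0 => u _; rewrite lee_fin mulr_ge0 ?ker_ge0.
apply: eq_integral => r _.
transitivity (\int[mu]_s ((phi r)%:E * (ker a (t - s) * ker b (s - r))%:E))%E.
  by apply: eq_integral => s _; rewrite /F -EFinM; congr EFin => /=; ring.
rewrite ge0_integralZl//; last 3 first.
- by apply/measurable_EFinP; exact: measurable_ker_conv.
- by move=> s _; rewrite lee_fin mulr_ge0 ?ker_ge0.
- by rewrite lee_fin.
by rewrite ker_conv_ker muleC -muleA -EFinM.
Qed.

End Semigroup.

(** * The semigroup law *)

Section SemigroupReal.
Context {R : realType}.
Notation mu := (@lebesgue_measure R).
Implicit Types (a b c t x : R) (f g : R -> R).

Lemma beta_int_itv a b : beta_int a b =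
  (\int[mu]_(u in `[0%R, 1%R]) (ker a (1 - u) * ker b u)%:E)%E.
Proof.
rewrite [RHS]integral_mkcond; apply: eq_integral => u _.
rewrite patchE; case: ifPn => //; rewrite notin_setE/= in_itv/= => /negP.
rewrite negb_and -!ltNge => /orP[u0|u1]; congr EFin.
  by rewrite {2}/ker ifF ?mulr0//; apply/negbTE; rewrite -leNgt ltW.
by rewrite {1}/ker ifF ?mul0r//; apply/negbTE; rewrite -leNgt; lra.
Qed.

(** On each half of the unit interval one of the two kernels is bounded and the
    other one is integrable. *)
Lemma beta_int_lty a b : 0 < a -> 0 < b -> (beta_int a b < +oo)%E.
Proof.
move=> a0 b0; pose C e : R := (1/2) `^ (e - 1) + 1 `^ (e - 1).
have C0 e : 0 <= C e by rewrite addr_ge0 ?powR_ge0.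
have kC e v : 1/2 <= v <= 1 -> ker e v <= C e.
  move=> /andP[v1 v2]; rewrite /ker ifT; last by lra.
  by apply: powR_le_ends => //; lra.
pose g u := ((C b)%:E * (ker a (1 - u))%:E + (C a)%:E * (ker b u)%:E)%E.
have ig : mu.-integrable `[0, 1] g.
  apply: integrableD => //=; apply: integrableZl => //.
  - exact: integrable_ker_sub.
  - apply/integrableP; split.
      by apply/measurable_EFinP; apply: measurable_funTS; exact: measurable_ker.
    under eq_integral do rewrite gee0_abs ?lee_fin ?ker_ge0//.
    exact: integral_ker01_lty.
have mg : measurable_fun [set: R] (fun u => ker a (1 - u) * ker b u).
  by have := measurable_ker_conv a b 0 1; under eq_fun do rewrite subr0.
rewrite beta_int_itv; apply: le_lt_trans (integrable_lty _ ig) => //.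
apply: ge0_le_integral => //.
- by move=> u _; rewrite lee_fin mulr_ge0 ?ker_ge0.
- by apply/measurable_EFinP; apply: measurable_funTS.
- exact: (measurable_int mu).
- move=> u; rewrite /= in_itv/= => /andP[u0 u1].
  rewrite /g -!EFinM -EFinD lee_fin.
  have [u2|u2] := leP u (1/2).
    apply: (@le_trans _ _ (C a * ker b u)).
      by apply: ler_wpM2r; [exact: ker_ge0|apply: kC; lra].
    by rewrite lerDr mulr_ge0 ?ker_ge0.
  apply: (@le_trans _ _ (C b * ker a (1 - u))).
    rewrite mulrC; apply: ler_wpM2r; [exact: ker_ge0|apply: kC; lra].
  by rewrite lerDl mulr_ge0 ?ker_ge0.
Qed.

(** On the middle half of the unit interval both kernels are bounded below by a
    positive constant. *)
Lemma beta_int_gt0 a b : (0 < beta_int a b)%E.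
Proof.
pose p : R := 1/4; pose q : R := 3/4.
pose c e : R := (p `^ (- (e - 1)) + q `^ (- (e - 1)))^-1.
have c0 e : 0 < c e by rewrite invr_gt0 addr_gt0// powR_gt0// /p /q; lra.
have kc e v : p <= v <= q -> c e <= ker e v.
  move=> /andP[pv vq]; have p0 : 0 < p by rewrite /p; lra.
  have v0 : 0 < v by exact: lt_le_trans pv.
  rewrite /ker v0 -[leRHS]invrK -powRN lef_pV2 ?posrE ?addr_gt0 ?powR_gt0//.
    exact: powR_le_ends.
  by rewrite /q; lra.
have mg : measurable_fun [set: R] (fun u => ker a (1 - u) * ker b u).
  by have := measurable_ker_conv a b 0 1; under eq_fun do rewrite subr0.
apply: (@lt_le_trans _ _ (\int[mu]_(u in `[p, q]) (c a * c b)%:E)%E).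
  rewrite integral_cst//= lebesgue_measure_itv/= lte_fin ifT; last by rewrite /p /q; lra.
  by rewrite -EFinB -EFinM lte_fin !mulr_gt0// /p /q; lra.
apply: (@le_trans _ _ (\int[mu]_(u in `[p, q]) (ker a (1 - u) * ker b u)%:E)%E).
  apply: ge0_le_integral => //.
  - by move=> u _; rewrite lee_fin mulr_ge0 ?ltW.
  - by apply/measurable_EFinP; apply: measurable_funTS.
  - move=> u; rewrite /= in_itv/= => /andP[pu uq].
    rewrite lee_fin; move: pu uq; rewrite /p /q => pu uq.
    by apply: ler_pM; [exact: ltW|exact: ltW|apply: kc|apply: kc]; rewrite /p /q; lra.
apply: ge0_subset_integral => //.
- by apply/measurable_EFinP.
- by move=> u _; rewrite lee_fin mulr_ge0 ?ker_ge0.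
Qed.

Definition beta_cst a b : R := fine (beta_int a b).

Lemma beta_cst_gt0 a b : 0 < a -> 0 < b -> 0 < beta_cst a b.
Proof. by move=> a0 b0; apply: fine_gt0; rewrite beta_int_gt0 beta_int_lty. Qed.

Lemma EFin_beta_cst a b : 0 < a -> 0 < b -> (beta_cst a b)%:E = beta_int a b.
Proof.
move=> a0 b0; rewrite /beta_cst fineK// ge0_fin_numE ?beta_int_lty//.
exact: ltW (beta_int_gt0 a b).
Qed.

Lemma EFin_fracint a f t : 0 < a -> continuous f ->
  (fracint a f t)%:E = (\int[mu]_s (ker a (t - s) * (f \_ `[0%R, +oo[) s)%:E)%E.
Proof.
move=> a0 cf; rewrite /fracint /Rintegral fineK; last first.
  by apply: integrable_fin_num => //; exact: integrable_ker_sub_mul.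
rewrite integral_mkcond; apply: eq_integral => s _.
rewrite !patchE; case: ifPn => [|].
  by rewrite inE/= in_itv/= => /andP[s0 _]; rewrite ifT// inE/= in_itv/= s0.
rewrite notin_setE/= in_itv/= => /negP; rewrite negb_and -!ltNge => /orP[s0|st].
  by rewrite ifF ?mulr0//; apply/negbTE; rewrite notin_setE/= in_itv/= andbT;
    apply/negP; rewrite -ltNge.
by rewrite {1}/ker ifF ?mul0r//; apply/negbTE; rewrite -leNgt; lra.
Qed.

Lemma ge0_fracint_comp a b f t : 0 < a -> 0 < b -> continuous f -> (forall x, 0 <= f x) ->
  fracint a (fracint b f) t = beta_cst a b * fracint (a + b) f t.
Proof.
move=> a0 b0 cf f0; apply: EFin_inj.
rewrite EFin_fracint//; last exact: continuous_fracint.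
rewrite EFinM EFin_beta_cst// EFin_fracint ?addr_gt0//.
rewrite -conv_ker_conv_ker//; last 2 first.
- apply/(measurable_restrictT _ _).1 => //; apply: measurable_funTS.
  exact: continuous_measurable_fun.
- by move=> x; rewrite patchE; case: ifP.
apply: eq_integral => s _; rewrite -EFin_fracint// -EFinM patchE.
case: ifPn => //; rewrite notin_setE/= in_itv/= andbT => /negP; rewrite -ltNge => s0.
by rewrite fracint_le0// ltW.
Qed.

(** The semigroup law of fractional integrals, up to a positive factor. The
    signed case follows by linearity from the positive and negative parts. *)
Lemma fracint_comp a b f t : 0 < a -> 0 < b -> continuous f ->
  fracint a (fracint b f) t = beta_cst a b * fracint (a + b) f t.
Proof.
move=> a0 b0 cf.
(* the positive and negative parts of f, written so that their continuity is
   immediate *)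
pose p x := 2^-1 * (`|f x| + f x); pose q x := 2^-1 * (`|f x| - f x).
have cn : continuous (fun x => `|f x|).
  by move=> x; apply: continuous_comp; [exact: cf|exact: norm_continuous].
have cp : continuous p.
  by move=> x; apply: cvgM; [exact: cvg_cst|apply: cvgD; [exact: cn|exact: cf]].
have cq : continuous q.
  by move=> x; apply: cvgM; [exact: cvg_cst|apply: cvgB; [exact: cn|exact: cf]].
have p0 x : 0 <= p x by rewrite mulr_ge0// -lerBlDr sub0r -normrN ler_norm.
have q0 x : 0 <= q x by rewrite mulr_ge0// subr_ge0 ler_norm.
have Jf c s : 0 < c -> fracint c f s = fracint c p s - fracint c q s.
  move=> c0; rewrite -fracintN// -fracintD//; last by move=> x; apply: cvgN; exact: cq.
  by apply: eq_fracint => x _; rewrite /p /q; lra.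
have Jc c g : 0 < c -> continuous g -> continuous (fracint c g).
  by move=> *; exact: continuous_fracint.
rewrite Jf ?addr_gt0// mulrBr -!ge0_fracint_comp// -fracintN//; last exact: Jc.
rewrite -fracintD//; [|exact: Jc|by move=> x; apply: cvgN; exact: Jc].
by apply: eq_fracint => s _; exact: Jf.
Qed.

Lemma continuous_iter_fracint1 k f : continuous f -> continuous (iter k (fracint 1) f).
Proof. by move=> cf; elim: k => //= k IH; exact: continuous_fracint. Qed.

Lemma iter_fracint1 k : exists2 c : R, 0 < c &
  forall f t, continuous f -> iter k.+1 (fracint 1) f t = c * fracint k.+1%:R f t.
Proof.
elim: k => [|k [c c0 IH]]; first by exists 1 => // f t _; rewrite mul1r.
exists (c * beta_cst 1 k.+1%:R); first by rewrite mulr_gt0 ?beta_cst_gt0.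
move=> f t cf; rewrite iterS.
rewrite (@eq_fracint _ _ _ (fun s => c * fracint k.+1%:R f s)); last by move=> s _; exact: IH.
rewrite fracintZ//; last exact: continuous_fracint.
by rewrite fracint_comp// mulrA; congr (_ * fracint _ f t).
Qed.

(** An integral of integer order is an iterated primitive, which is undone by
    differentiating. *)
Lemma fracint_nat_inj k f : continuous f ->
  (forall t, 0 < t -> fracint k.+1%:R f t = 0) -> forall t, 0 < t -> f t = 0.
Proof.
move=> cf; have [c c0 E] := iter_fracint1 k.
move=> J0; have : forall t, 0 < t -> iter k.+1 (fracint 1) f t = 0.
  by move=> t t0; rewrite E// J0// mulr0.
elim: k.+1 => //= {E J0}m IH I0; apply: IH => t t0.
have [_ <-] := is_derive_fracint1 (@continuous_iter_fracint1 m _ cf) t0.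
have -> : 'D_1 (fracint 1 (iter m (fracint 1) f)) t = 'D_1 (cst 0 : R -> R) t.
  by apply: near_eq_derive; rewrite ?oner_eq0//; near=> s; apply: I0; near: s; exact: lt_nbhsr.
by rewrite derive_cst.
Unshelve. all: by end_near. Qed.

End SemigroupReal.

(** * Taylor expansion on the half-line *)

Section OneVariable.
Context {R : realType}.
Implicit Types (a b c t x : R) (f g : R -> R) (p : {poly R}).

Lemma derive0_constant_pos f : (forall t, 0 < t -> is_derive t 1 f 0) ->
  forall s t, 0 < s -> 0 < t -> f s = f t.
Proof.
move=> df; have le s t : 0 < s -> s <= t -> f s = f t.
  move=> s0 st.
  have [||c _] := @MVT_segment R f (fun=> 0) s t st.
  - by move=> x; rewrite in_itv/= => /andP[sx _]; apply: df; exact: lt_trans sx.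
  - apply: derivable_within_continuous => x; rewrite in_itv/= => /andP[sx _].
    by have [] := df x (lt_le_trans s0 sx).
  - by rewrite mul0r => /eqP; rewrite subr_eq0 => /eqP.
move=> s t s0 t0; have [st|ts] := leP s t; first exact: le.
by apply/esym/le => //; exact: ltW.
Qed.

Lemma antiderivative_poly p : exists2 q : {poly R},
  q^`() = p & (size q <= (size p).+1)%N.
Proof.
exists (\poly_(i < (size p).+1) (p`_i.-1 / i%:R)); last exact: size_poly.
apply/polyP => i; rewrite coef_deriv coef_poly ltnS.
case: ltnP => [ip|pi]; last by rewrite mul0rn nth_default.
by rewrite -[LHS]mulr_natr -mulrA mulVf ?mulr1// pnatr_eq0.
Qed.

(** A function whose [m]-th derivative vanishes is a polynomial. The successive
    derivatives are given as a family [u] so that differences of derivatives can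
    be used without computing the derivatives of a difference. *)
Lemma poly_of_derivatives m (u : nat -> R -> R) :
  (forall k t, (k < m)%N -> 0 < t -> is_derive t 1 (u k) (u k.+1 t)) ->
  (forall t, 0 < t -> u m t = 0) ->
  exists2 p : {poly R}, (size p <= m)%N & forall t, 0 < t -> u 0 t = p.[t].
Proof.
elim: m u => [|m IH] u du um.
  by exists 0; [rewrite size_poly0|move=> t t0; rewrite um// horner0].
have [p sp up] : exists2 p : {poly R}, (size p <= m)%N &
    forall t, 0 < t -> u 1 t = p.[t].
  by apply: (IH (fun k => u k.+1)) => [k t km t0|t t0]; [exact: du|exact: um].
have [q qp sq] := antiderivative_poly p.
have cst_uq : forall s t, 0 < s -> 0 < t -> u 0 s - q.[s] = u 0 t - q.[t].
  apply: (@derive0_constant_pos (fun t => u 0 t - q.[t])) => t t0.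
  apply: (is_derive_eq (is_deriveB (du 0%N t isT t0) (is_derive_poly q t))).
  by rewrite qp up// subrr.
exists (q + (u 0 1 - q.[1])%:P).
  apply: (leq_trans (size_polyD _ _)); rewrite geq_max (leq_trans sq)//=.
  by rewrite (leq_trans (size_polyC_leq1 _)).
by move=> t t0; rewrite hornerD hornerC (cst_uq 1 t)// addrC subrK.
Qed.

(** Such a polynomial vanishes at [0]; dividing it by ['X] lowers both its degree
    and the order of smallness, and the induction ends with a constant. *)
Lemma small_poly_eq0 m p : (size p <= m.+1)%N ->
  (forall e, 0 < e -> exists2 d, 0 < d & forall t, 0 < t < d -> `|p.[t]| <= e * t ^+ m) ->
  p = 0.
Proof.
elim: m p => [|m IH] p sp small.
  have [c pE] : exists c, p = c%:P by exists p`_0; exact: size1_polyC.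
  subst p; congr (_%:P); apply/eqP.
  rewrite -normr_le0; apply/ler_addgt0Pl => e e0; rewrite addr0.
  have [d d0 /(_ (d / 2))] := small e e0.
  rewrite hornerC expr0 mulr1; apply.
  by rewrite divr_gt0//= ltr_pdivrMr// ltr_pMr// ltr1n.
have p0 : root p 0.
  rewrite /root -normr_le0; apply/ler_addgt0Pl => e e0; rewrite addr0.
  have e20 : 0 < e / 2 by rewrite divr_gt0.
  have [d d0 pd] := small _ e20.
  have /cvgrPdist_le /(_ _ e20) [d' /= d'0 pd'] := @continuous_horner R p 0.
  pose t := Num.min (Num.min (d / 2) (d' / 2)) 1.
  have t0 : 0 < t by rewrite !lt_min !divr_gt0//=.
  have td : t < d.
    by rewrite !gt_min ltr_pdivrMr// ltr_pMr// ltr1n.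
  have td' : t < d'.
    by rewrite !gt_min [d' / 2 < _]ltr_pdivrMr// ltr_pMr// ltr1n orbT.
  have t1 : t <= 1 by rewrite ge_min lexx orbT.
  have -> : p.[0] = (p.[0] - p.[t]) + p.[t] by rewrite subrK.
  apply: (le_trans (ler_normD _ _)); rewrite [leRHS]splitr lerD//.
    by apply: pd'; rewrite /= sub0r normrN gtr0_norm.
  apply: (le_trans (pd _ _)); first by rewrite t0.
  by rewrite ler_piMr ?(ltW e20)// exprn_ile1// ltW.
have [q pE] := factor_theorem _ _ p0.
rewrite pE subr0 in small sp *.
suff -> : q = 0 by rewrite mul0r.
apply: IH.
  have [->|q0] := eqVneq q 0; first by rewrite size_poly0.
  by move: sp; rewrite size_mulX.
move=> e e0; have [d d0 H] := small e e0; exists d => // t td.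
have /andP[t0 _] := td; move: (H t td).
by rewrite hornerMX normrM (gtr0_norm t0) exprSr mulrA ler_pM2r.
Qed.

End OneVariable.

Section HalfLine.
Context {R : realType}.
Implicit Types (a b c t x : R) (f g : R -> R) (p : {poly R}).

(** Clamping the argument at [0] replaces continuity on the half-line by
    continuity on the whole line, without changing the values at [t >= 0]. *)
Lemma continuous_ext_max0 f : {within `[0, +oo[, continuous f} ->
  continuous (fun t => f (Num.max 0 t)).
Proof.
move=> /continuous_within_itvcyP[cf cf0] t.
have [t0|t0|<-] := ltgtP 0 t.
- have ct : {for t, continuous f} by apply: cf; rewrite in_itv/= t0.
  rewrite /continuous_at (max_idPr (ltW t0)); apply: cvg_trans ct.
  apply: near_eq_cvg; near=> s; rewrite (max_idPr _)//.
  by apply: ltW; near: s; exact: lt_nbhsr.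
- rewrite /continuous_at (max_idPl (ltW t0)).
  apply: cvg_near_cst; near=> s; rewrite (max_idPl _)//.
  by apply: ltW; near: s; exact: lt_nbhsl.
- rewrite /continuous_at ?maxxx; apply/cvgrPdist_lt => e e0.
  have /cvgrPdist_lt/(_ _ e0) [d /= d0 H] := cf0.
  exists d => //= s sd; have [s0|s0] := ltP 0 s; first exact: H.
  by rewrite subrr normr0.
Unshelve. all: by end_near. Qed.

Lemma half_nbhs_pos t : 0 < t -> half_nbhs t = 0^'.
Proof.
move=> t0; apply/seteqP; split => A.
  rewrite /half_nbhs /within /= => HA; near=> h.
  have : 0 <= h + t -> A h by near: h.
  apply; rewrite -lerBlDr sub0r ltW//.
  by near: h; apply: nbhs_dnbhs; apply: lt_nbhsr; rewrite oppr_lt0.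
by rewrite /half_nbhs /within /= => HA; near=> h => _; near: h.
Unshelve. all: by end_near. Qed.

Lemma half_derivable_pos f t : 0 < t -> half_derivable f t ->
  is_derive t 1 f (half_deriv f t).
Proof.
move=> t0; have E := half_nbhs_pos t0; rewrite /half_derivable /half_deriv E.
rewrite (_ : half_quotient f t = fun h => h^-1 *: ((f \o shift t) (h *: 1) - f t)).
  by move=> df; split.
by apply/funext => h; rewrite /half_quotient /= /GRing.scale/= mulr1.
Qed.

Lemma half_derivnSr k f : half_derivn k (half_deriv f) = half_derivn k.+1 f.
Proof. by rewrite /half_derivn iterSr. Qed.

Definition taylor_poly n f : {poly R} := \poly_(k < n) (half_derivn k f 0 / k`!%:R).

Lemma taylor_remainderE n f t : taylor_remainder n f t = f t - (taylor_poly n f).[t].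
Proof. by rewrite /taylor_remainder /taylor_poly horner_poly. Qed.

Lemma deriv_taylor_poly n f : (taylor_poly n.+1 f)^`() = taylor_poly n (half_deriv f).
Proof.
apply/polyP => i; rewrite coef_deriv !coef_poly ltnS.
case: ifP => // _; last by rewrite mul0rn.
rewrite half_derivnSr factS natrM -[LHS]mulr_natr invfM -!mulrA.
by congr (_ * _); rewrite mulrCA mulVf ?mulr1// pnatr_eq0.
Qed.

Lemma half_C_deriv n f : half_C n.+1 f -> half_C n (half_deriv f).
Proof.
move=> [df cf]; split => k; rewrite half_derivnSr.
  by move=> t kn t0; exact: (df k.+1 t kn t0).
by move=> kn; exact: (cf k.+1 kn).
Qed.

Lemma half_CW m n f : (m <= n)%N -> half_C n f -> half_C m f.
Proof.
move=> mn [df cf]; split => k; first by move=> t km; apply: df; exact: leq_trans km mn.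
by move=> km; apply: cf; exact: leq_trans mn.
Qed.

Lemma half_C_continuous n f : half_C n f -> {within `[0, +oo[, continuous f}.
Proof. by move=> [_ /(_ 0%N)]; exact. Qed.

Lemma continuous_taylor_remainder m n f : half_C m f ->
  continuous (fun t => taylor_remainder n f (Num.max 0 t)).
Proof.
move=> fC t.
have -> : (fun t => taylor_remainder n f (Num.max 0 t)) =
    (fun t => f (Num.max 0 t) - (taylor_poly n f).[Num.max 0 t]).
  by apply/funext => s; rewrite taylor_remainderE.
apply: cvgB; first exact: (continuous_ext_max0 (half_C_continuous fC)).
have cm : {for t, continuous (fun s : R => Num.max 0 s)}.
  by apply: continuous_max; [exact: cst_continuous|exact: cvg_id].
exact: (continuous_comp cm (@continuous_horner _ _ _)).
Qed.

(** Peano's form of Taylor's theorem at the end point: the derivative of the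
    remainder of [f] is the remainder of the derivative of [f], so the mean value
    theorem raises the order of smallness by one. *)
Lemma taylor_remainder_small n f : half_C n f -> forall e, 0 < e ->
  exists2 d, 0 < d & forall t, 0 <= t < d -> `|taylor_remainder n.+1 f t| <= e * t ^+ n.
Proof.
elim: n f => [|n IH] f fC e e0.
  have /(continuous_ext_max0) /(_ 0) := half_C_continuous fC.
  move=> /cvgrPdist_le /(_ _ e0) [d /= d0 H]; exists d => // t /andP[t0 td].
  rewrite /taylor_remainder big_ord1 expr0 !mulr1 fact0 divr1 /=.
  have := H t; rewrite /= sub0r normrN ger0_norm// => /(_ td).
  by rewrite distrC maxxx (max_idPr t0).
have [d d0 H] := IH _ (half_C_deriv fC) e e0.
exists d => // t /andP[+ td]; rewrite le_eqVlt => /predU1P[<-|t0].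
  rewrite taylor_remainderE horner_coef0 coef_poly /= fact0 divr1 subrr normr0.
  by rewrite mulr_ge0 ?exprn_ge0// ltW.
pose r := taylor_remainder n.+2 f.
have [||c] := @MVT R r (taylor_remainder n.+1 (half_deriv f)) 0 t t0.
- move=> x; rewrite in_itv/= => /andP[x0 xt].
  rewrite taylor_remainderE -deriv_taylor_poly.
  rewrite (_ : r = f - horner (taylor_poly n.+2 f)); last first.
    by apply/funext => y; rewrite /r taylor_remainderE.
  have dfx : half_derivable f x by have [dC _] := fC; exact: (dC 0%N x isT (ltW x0)).
  exact: (is_deriveB (half_derivable_pos x0 dfx) (is_derive_poly _ x)).
- have := continuous_subspaceT (A := `[0, t]) (@continuous_taylor_remainder _ n.+2 _ fC).
  apply: subspace_eq_continuous => s; rewrite inE/= in_itv/= => /andP[s0 _].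
  by rewrite /from_subspace /r max_r.
move=> cin; rewrite subr0 {2}/r taylor_remainderE horner_coef0 coef_poly /= fact0 divr1 subrr.
rewrite subr0 => rt; rewrite -/r rt normrM (gtr0_norm t0) exprSr mulrA ler_pM2r//.
move: cin; rewrite in_itv/= => /andP[c0 ct].
apply: (le_trans (H c _)); first by rewrite ltW//= (lt_trans ct).
by rewrite ler_pM2l// lerXn2r ?nnegrE ?ltW.
Qed.

End HalfLine.

(** * Inversion of the Caputo derivative *)

Section Inversion.
Context {R : realType}.
Implicit Types (a b c t : R) (f g h x : R -> R).

Lemma order_ceilP a : 0 < a ->
  exists m, order_ceil a = m.+1 /\ m%:R < a <= m.+1%:R.
Proof.
move=> a0; have := ceil_ge a; have := gt_pred_ceil a.
have : (0 < Num.ceil a)%R by rewrite ceil_gt0.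
rewrite /order_ceil; case: (Num.ceil a) => // -[//|m] _ /=.
rewrite -[m.+1]addn1 PoszD addrK => lt ge; exists m; split; first by rewrite addn1.
by rewrite lt -[m.+1]addn1.
Qed.

(** In this section [w] is the function whose derivative of order [m + 1] is the
    Caputo derivative, [dlt] is the order of the fractional integral that produces
    it from the Taylor remainder [y], and [h] is a continuous function on the
    whole line that agrees with the Caputo derivative at positive times. *)
Section inversion.
Variables (a : R) (x h : R -> R) (m : nat).
Hypotheses (a0 : 0 < a) (am : order_ceil a = m.+1) (ma : m%:R < a <= m.+1%:R).
Hypotheses (xC : half_C m x) (xE : caputo_exists a x) (ch : continuous h).
Hypothesis (hE : forall t, 0 < t -> caputo a x t = h t).

Let w := caputo_primitive a x.
Let dlt : R := m.+1%:R - a.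
Let y t := taylor_remainder m.+1 x (Num.max 0 t).

Let cy : continuous y. Proof. exact: continuous_taylor_remainder xC. Qed.

Let dlt_ge0 : 0 <= dlt. Proof. by case/andP: ma => *; rewrite /dlt subr_ge0. Qed.
Let dlt_lt1 : dlt < 1.
Proof. by case/andP: ma => *; rewrite /dlt ltrBlDl -natr1 ltrD2r. Qed.

Lemma remainder_clampE t : 0 <= t -> y t = taylor_remainder m.+1 x t.
Proof. by move=> t0; rewrite /y max_r. Qed.

Lemma primitive_eq0 t : dlt = 0 -> 0 < t -> w t = y t.
Proof.
move=> d0 t0; rewrite /w /caputo_primitive am -/dlt d0 /RLintegral eqxx.
by rewrite remainder_clampE// ltW.
Qed.

Lemma primitive_fracint t : 0 < dlt -> w t = (Gamma dlt)^-1 * fracint dlt y t.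
Proof.
move=> d0; rewrite /w /caputo_primitive am -/dlt /RLintegral gt_eqF//.
congr (_ * _); rewrite -fracintE//; apply: eq_Rintegral => s.
by rewrite inE/= in_itv/= => /andP[s0 _]; rewrite remainder_clampE.
Qed.

Lemma small_remainder e : 0 < e -> exists2 d, 0 < d &
  forall t, 0 <= t < d -> `|y t| <= e * t ^+ m.
Proof.
move=> e0; have [d d0 H] := taylor_remainder_small xC e0.
by exists d => // t td; rewrite remainder_clampE ?H//; case/andP: td.
Qed.

(** The Taylor remainder is [o(t ^ m)], and a fractional integral does not
    increase the order of magnitude near [0]. *)
Lemma small_primitive e : 0 < e -> exists2 d, 0 < d &
  forall t, 0 < t < d -> `|w t| <= e * t ^+ m.
Proof.
move=> e0; have [d0|d0] := eqVneq dlt 0.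
  have [d dp H] := small_remainder e0; exists d => // t /andP[t0 td].
  by rewrite primitive_eq0// H// ltW.
have dp : 0 < dlt by rewrite lt_neqAle eq_sym d0.
pose C := (Gamma dlt)^-1 * fracint dlt (fun=> 1) 1.
have G0 : 0 < Gamma dlt by rewrite Gamma_gt0// dp ltW.
have C0 : 0 <= C by apply: mulr_ge0; [rewrite invr_ge0 ltW|exact: fracint_ge0].
(* C + 1 rather than C, which may vanish *)
have e'0 : 0 < e / (C + 1) by rewrite divr_gt0// ltr_wpDl.
have [d d_0 H] := small_remainder e'0.
exists (Num.min d 1); first by rewrite lt_min d_0/=.
move=> t /andP[t0]; rewrite lt_min => /andP[td t1].
rewrite primitive_fracint// normrM gtr0_norm ?invr_gt0//.
have yM s : 0 <= s <= t -> `|y s| <= e / (C + 1) * t ^+ m.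
  move=> /andP[s0 st]; apply: (le_trans (H _ _)); first by rewrite s0 (le_lt_trans st).
  by rewrite ler_pM2l// lerXn2r ?nnegrE// ltW.
have := normr_fracint_le dp (ltW t0) cy yM.
rewrite -(@ler_pM2l _ (Gamma dlt)^-1) ?invr_gt0// => /le_trans; apply.
rewrite [leLHS](_ : _ = e * t ^+ m * (t `^ dlt * (C / (C + 1)))); last by rewrite /C; ring.
apply: ler_piMr; first by rewrite mulr_ge0 ?exprn_ge0 ?ltW.
apply: mulr_ile1; first exact: powR_ge0.
- by rewrite divr_ge0// addr_ge0.
- have -> : 1 = 1 `^ dlt by rewrite powR1.
  by rewrite ge0_ler_powR ?nnegrE ?ltW.
- by rewrite ler_pdivrMr ?mul1r ?lerDl// ltr_wpDl.
Qed.

Lemma small_iter_fracint1 e : 0 < e -> exists2 d, 0 < d &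
  forall t, 0 < t < d -> `|iter m.+1 (fracint 1) h t| <= e * t ^+ m.
Proof.
move=> e0; have [c c0 E] := @iter_fracint1 R m.
have [M M0 hM] := continuous_bounded_itv 0 1 ch.
pose C := c * M * fracint m.+1%:R (fun=> 1) 1.
have C0 : 0 <= C by apply: mulr_ge0; [rewrite mulr_ge0// ltW|exact: fracint_ge0].
exists (Num.min (e / (C + 1)) 1).
  by rewrite lt_min ltr01 andbT divr_gt0// ltr_wpDl.
move=> t /andP[t0]; rewrite lt_min => /andP[td t1].
rewrite E// normrM (gtr0_norm c0).
have hMt s : 0 <= s <= t -> `|h s| <= M.
  by move=> /andP[s0 st]; apply: hM; rewrite s0 (le_trans st)// ltW.
have m0 : 0 < m.+1%:R :> R by rewrite ltr0n.
have := normr_fracint_le m0 (ltW t0) ch hMt.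
rewrite -(ler_pM2l c0) => /le_trans; apply.
rewrite powR_mulrn; last exact: ltW.
rewrite [leLHS](_ : _ = C * t * t ^+ m); last by rewrite exprS /C; ring.
apply: ler_wpM2r; first by rewrite exprn_ge0 ?ltW.
move: td; rewrite ltr_pdivlMr ?ltr_wpDl// => /ltW; apply: le_trans.
by rewrite mulrC; apply: ler_wpM2l; [exact: ltW|rewrite lerDl].
Qed.

(** The difference of the two sides has a vanishing derivative of order [m + 1],
    hence is a polynomial of degree at most [m]; both sides are [o(t ^ m)] at
    [0], so this polynomial is zero. *)
Lemma primitive_iter_fracint1 t : 0 < t -> w t = iter m.+1 (fracint 1) h t.
Proof.
pose u k t := derive1n k w t - iter (m.+1 - k) (fracint 1) h t.
have [|t' t'0|p sp up] := @poly_of_derivatives R m.+1 u.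
- move=> k s km s0; rewrite /u.
  have dw : derivable (derive1n k w) s 1 by apply: xE => //; rewrite am.
  have dw' : is_derive s 1 (derive1n k w) (derive1n k.+1 w s).
    by split; [exact: dw|rewrite derive1nS derive1E].
  rewrite subSS (subSn (ltnSE km)) iterS.
  exact: (is_deriveB dw' (is_derive_fracint1 (@continuous_iter_fracint1 _ (m - k) _ ch) s0)).
- by rewrite /u subnn /= -hE// /caputo am subrr.
suff p0 : p = 0.
  move=> t0; apply/eqP; rewrite -subr_eq0; apply/eqP.
  by have := up t t0; rewrite p0 horner0 /u subn0.
apply: (small_poly_eq0 sp) => e e0.
have e20 : 0 < e / 2 by rewrite divr_gt0.
have [d1 d10 H1] := small_primitive e20; have [d2 d20 H2] := small_iter_fracint1 e20.
exists (Num.min d1 d2) => [|s /andP[s0]]; first by rewrite lt_min d10.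
rewrite lt_min => /andP[sd1 sd2]; rewrite -up// /u subn0.
apply: (le_trans (ler_normB _ _)); rewrite [e]splitr mulrDl lerD//.
  by apply: H1; rewrite s0.
by apply: H2; rewrite s0.
Qed.

(** By the previous lemma, integrating [y] to the order [dlt] amounts to
    integrating [h] to the order [m + 1 = a + dlt]. Integrating both sides to the
    order [a] and commuting the orders, [y] and a multiple of the fractional
    integral of order [a] of [h] have the same iterated primitive, hence are
    equal. *)
Lemma inversion_aux : exists2 c, 0 < c & forall t, 0 < t ->
  taylor_remainder m.+1 x t = c * fracint a h t.
Proof.
have [c c0 E] := @iter_fracint1 R m.
have [d0|dn0] := eqVneq dlt 0.
  have <- : m.+1%:R = a by apply/eqP; rewrite -subr_eq0; apply/eqP.
  exists c; first exact: c0.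
  move=> t t0; rewrite -(remainder_clampE (ltW t0)) -(primitive_eq0 d0 t0).
  rewrite (primitive_iter_fracint1 t0).
  exact: E.
have dp : 0 < dlt by rewrite lt_neqAle eq_sym dn0.
have G0 : 0 < Gamma dlt by rewrite Gamma_gt0// dp ltW.
have m0 : 0 < m.+1%:R :> R by rewrite ltr0n.
have b1 : 0 < beta_cst a dlt by exact: beta_cst_gt0.
have b2 : 0 < beta_cst a m.+1%:R by exact: beta_cst_gt0.
have b3 : 0 < beta_cst m.+1%:R a by exact: beta_cst_gt0.
pose k := Gamma dlt * c * beta_cst a m.+1%:R / (beta_cst m.+1%:R a * beta_cst a dlt).
have k0 : 0 < k.
  by apply: divr_gt0; apply: mulr_gt0; [exact: mulr_gt0|exact: b2|exact: b3|exact: b1].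
exists k => // t t0; rewrite -remainder_clampE ?ltW//; apply/eqP; rewrite -subr_eq0; apply/eqP.
have cJ : continuous (fracint a h) by exact: continuous_fracint.
have ckJ : continuous (fun s => - (k * fracint a h s)).
  by move=> s; apply: cvgN; apply: cvgM; [exact: cvg_cst|exact: cJ].
have fracint_remainder s : fracint dlt y s = Gamma dlt * c * fracint m.+1%:R h s.
  have [s0|s0] := ltP 0 s; last by rewrite !fracint_le0// mulr0.
  rewrite -mulrA -E// -primitive_iter_fracint1// primitive_fracint//.
  by rewrite mulrA divff ?mul1r// gt_eqF.
apply: (@fracint_nat_inj _ m (fun s => y s - k * fracint a h s)) t0.
  by move=> s; apply: cvgD; [exact: cy|exact: ckJ].
move=> s s0; rewrite fracintD// fracintN//; last first.
  by move=> r; apply: cvgM; [exact: cvg_cst|exact: cJ].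
rewrite fracintZ// fracint_comp//.
have : fracint a (fracint dlt y) s =
    Gamma dlt * c * (beta_cst a m.+1%:R * fracint (a + m.+1%:R) h s).
  rewrite (@eq_fracint _ _ _ (fun s => Gamma dlt * c * fracint m.+1%:R h s)); last first.
    by move=> r _; exact: fracint_remainder.
  rewrite (fracintZ _ a0); last exact: continuous_fracint.
  by rewrite (fracint_comp _ a0 m0 ch).
have adE : a + dlt = m.+1%:R by rewrite /dlt addrC subrK.
rewrite fracint_comp// adE [a + _]addrC => eq_y.
have b1n := lt0r_neq0 b1; have b3n := lt0r_neq0 b3.
apply: (mulfI b1n); rewrite mulr0 mulrBr eq_y /k.
move: (beta_cst a dlt) (beta_cst _ a) (beta_cst a _) (Gamma dlt) (fracint _ h s) b1n b3n
  => p q r G X p0 q0.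
by field; rewrite p0 q0.
Qed.

End inversion.

(** The Caputo derivative is inverted by the fractional integral of the same
    order: a function is recovered, up to its Taylor polynomial, from a
    continuous extension [h] of its derivative. *)
Lemma caputo_inversion a x h : 0 < a -> half_C (order_ceil a).-1 x ->
  caputo_exists a x -> continuous h -> (forall t, 0 < t -> caputo a x t = h t) ->
  exists2 c, 0 < c & forall t, 0 < t ->
    taylor_remainder (order_ceil a) x t = c * fracint a h t.
Proof.
move=> a0; have [m [am ma]] := order_ceilP a0; rewrite am /= => xC xE ch hE.
exact: inversion_aux.
Qed.

End Inversion.

(** * Growth of fractional integrals *)

Section Growth.
Context {R : realType}.
Notation mu := (@lebesgue_measure R).
Implicit Types (a b c e t u : R) (f g phi psi : R -> R) (p : {poly R}).

(** A function with this property cannot have lower limit [-oo] after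
    multiplication by [t `^ e]; it is stable under sums and nonnegative
    multiples, so the terms of the equation can be treated one by one. *)
Definition weighted_lbound e phi : Prop :=
  exists C T, forall t, T <= t -> - C <= t `^ e * phi t.

Lemma powR_le1 t u : 1 <= t -> u <= 0 -> t `^ u <= 1.
Proof. by move=> t1 u0; rewrite -(powRr0 t) ler_powR. Qed.

Lemma weighted_lboundD e phi psi : weighted_lbound e phi -> weighted_lbound e psi ->
  weighted_lbound e (fun t => phi t + psi t).
Proof.
move=> [C [T H]] [C' [T' H']]; exists (C + C'), (Num.max T T') => t.
by rewrite ge_max => /andP[/H ? /H' ?]; rewrite mulrDr opprD lerD.
Qed.

Lemma weighted_lboundZ e k phi : 0 <= k -> weighted_lbound e phi ->
  weighted_lbound e (fun t => k * phi t).
Proof.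
move=> k0 [C [T H]]; exists (k * C), T => t /H Ht.
by rewrite mulrCA -mulrN ler_wpM2l.
Qed.

Lemma weighted_lbound_ge0 e phi T : (forall t, T <= t -> 0 <= phi t) ->
  weighted_lbound e phi.
Proof.
by move=> H; exists 0, T => t /H Ht; rewrite oppr0 mulr_ge0// powR_ge0.
Qed.

Lemma weighted_lbound_powR e u M T phi : e + u <= 0 ->
  (forall t, T <= t -> 1 <= t -> - (M * t `^ u) <= phi t) -> weighted_lbound e phi.
Proof.
move=> eu H; exists `|M|, (Num.max T 1) => t; rewrite ge_max => /andP[Tt t1].
have t0 : 0 < t by exact: lt_le_trans t1.
apply: (@le_trans _ _ (t `^ e * - (M * t `^ u))); last first.
  by apply: ler_wpM2l; [exact: powR_ge0|exact: H].
have tn : t != 0 by rewrite gt_eqF.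
rewrite mulrN lerN2 mulrCA -powRD ?tn ?implybT//.
apply: (@le_trans _ _ (`|M| * t `^ (e + u))).
  by apply: ler_wpM2r; [exact: powR_ge0|exact: ler_norm].
by apply: ler_piMr => //; exact: powR_le1.
Qed.

(** Only the part of the integral over [[0, T]] can be negative, and for
    [t >= T + 1] the kernel is evaluated there between [1] and [t]. *)
Lemma fracint_lbound a phi T : 0 < a -> continuous phi -> 0 <= T ->
  (forall t, T <= t -> 0 <= phi t) ->
  exists M, forall t, T + 1 <= t -> - (M * (1 + t `^ (a - 1))) <= fracint a phi t.
Proof.
move=> a0 cphi T0 phi0; have [M M0 phiM] := continuous_bounded_itv 0 T cphi.
exists (M * T) => t Tt; have Tt' : T <= t by rewrite (le_trans _ Tt)// lerDl.
have iJ := integrable_ker_sub_mul t a0 cphi.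
have := @Rintegral_itvB R (fun s => ker a (t - s) * phi s) (BLeft 0) (BRight t) T iJ.
rewrite !bnd_simp => /(_ T0 Tt') split_J.
apply: (@le_trans _ _ (\int[mu]_(s in `[0, T]) (ker a (t - s) * phi s))); last first.
  rewrite -subr_ge0 /fracint split_J; apply: Rintegral_ge0 => s.
  rewrite /= in_itv/= => /andP[Ts st].
  by rewrite mulr_ge0 ?ker_ge0 ?phi0// ltW.
pose k := - (M * (1 + t `^ (a - 1))).
have -> : - (M * T * (1 + t `^ (a - 1))) = \int[mu]_(s in `[0, T]) k.
  rewrite Rintegral_cst//= lebesgue_measure_itv/= lte_fin.
  have [T1|T1] := ltP 0 T; first by rewrite -EFinB/= /k; ring.
  have -> : T = 0 by apply/eqP; rewrite eq_le T0 T1.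
  by rewrite !(mulr0, mul0r) oppr0.
apply: le_Rintegral => //.
- apply: continuous_compact_integrable; first exact: segment_compact.
  by apply: continuous_subspaceT; exact: cst_continuous.
- by apply: integrableS iJ => // s; rewrite /= !in_itv/= => /andP[-> sT]; exact: le_trans Tt'.
move=> s; rewrite /= in_itv/= => /andP[s0 sT].
have : `|ker a (t - s) * phi s| <= M * (1 + t `^ (a - 1)).
  rewrite normrM mulrC ler_pM ?phiM ?s0// (ger0_norm (ker_ge0 _ _)).
  rewrite /ker ifT; last by lra.
  by have := @powR_le_ends R 1 t (t - s) (a - 1); rewrite powR1; apply; lra.
by rewrite ler_norml => /andP[].
Qed.

Lemma weighted_lbound_fracint e a phi T : 0 < a -> e <= 0 -> e + (a - 1) <= 0 ->
  continuous phi -> 0 <= T -> (forall t, T <= t -> 0 <= phi t) ->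
  weighted_lbound e (fracint a phi).
Proof.
move=> a0 e0 ea cphi T0 phi0; have [M H] := fracint_lbound a0 cphi T0 phi0.
have lb1 : weighted_lbound e (fun t => - (`|M| * t `^ 0)).
  by apply: (@weighted_lbound_powR _ 0 `|M| 0); rewrite ?addr0.
have lb2 : weighted_lbound e (fun t => - (`|M| * t `^ (a - 1))).
  by apply: (@weighted_lbound_powR _ (a - 1) `|M| 0).
have [C [T' HT]] := weighted_lboundD lb1 lb2.
exists C, (Num.max (T + 1) T') => t; rewrite ge_max => /andP[Tt T't].
apply: (le_trans (HT t T't)); apply: ler_wpM2l; first exact: powR_ge0.
apply: le_trans (H t Tt); rewrite powRr0 -opprD -mulrDr lerN2.
by apply: ler_wpM2r; [rewrite addr_ge0// powR_ge0|exact: ler_norm].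
Qed.

Lemma horner_le p k t : (size p <= k.+1)%N -> 1 <= t -> forall s, 0 <= s <= t ->
  `|p.[s]| <= (\sum_(i < k.+1) `|p`_i|) * t ^+ k.
Proof.
move=> sp t1 s /andP[s0 st]; rewrite (horner_coef_wide _ sp) mulr_suml.
apply: (le_trans (ler_norm_sum _ _ _)); apply: ler_sum => i _.
rewrite normrM ler_wpM2l// normrX (ger0_norm s0).
apply: (@le_trans _ _ (t ^+ i)); first by rewrite lerXn2r ?nnegrE// (le_trans s0).
by rewrite ler_weXn2l// -ltnS.
Qed.

(** The memory of the past grows too slowly to matter: after multiplication by
    [t `^ (- d - (k + 1) + 1)] the polynomials and the values of [X] and [F] before
    [T] contribute bounded terms, while the values after [T] contribute with a
    favourable sign. The exponents left by the weight are [- d] for [P], [m - k]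
    for [Q], [a - d - (k + 1)] and [- (k + 1)] for the past of [F] and of [X],
    none of them positive; neither is the exponent of the weight. *)
Lemma weighted_lbound_solution a d k m (A B : R) (G X F : R -> R) (P Q : {poly R}) T :
  0 < d < a -> a <= k.+1%:R -> (m <= k)%N -> 0 <= A -> 0 <= B ->
  (size P <= k.+1)%N -> (size Q <= m.+1)%N ->
  continuous X -> continuous F -> 0 <= T ->
  (forall t, T <= t -> 0 <= X t) -> (forall t, T <= t -> F t <= 0) ->
  (forall t, 0 < t ->
    G t = A * (X t - P.[t]) + B * (fracint d X t - fracint d (horner Q) t) - fracint a F t) ->
  weighted_lbound (- d - k.+1%:R + 1) G.
Proof.
move=> /andP[d0 da] ak mk A0 B0 sP sQ cX cF T0 X0 F0 GE.
have a0 : 0 < a by exact: lt_trans da.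
have mk' : m%:R <= k%:R :> R by rewrite ler_nat.
have k0 : 0 <= k%:R :> R by rewrite ler0n.
rewrite -natr1 in ak *.
set e := - d - _ + 1.
have lbX : weighted_lbound e (fun t => A * X t).
  by apply: weighted_lboundZ => //; exact: weighted_lbound_ge0 X0.
have lbP : weighted_lbound e (fun t => A * - P.[t]).
  apply: weighted_lboundZ => //.
  apply: (@weighted_lbound_powR _ k%:R (\sum_(i < k.+1) `|P`_i|) 0).
    by rewrite /e; lra.
  move=> t _ t1; rewrite lerN2 powR_mulrn ?(le_trans ler01)//.
  by apply: (le_trans (ler_norm _)); apply: horner_le => //; lra.
have lbJX : weighted_lbound e (fun t => B * fracint d X t).
  apply: weighted_lboundZ => //.
  by apply: (weighted_lbound_fracint (T := T)) => //; rewrite /e; lra.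
have lbJQ : weighted_lbound e (fun t => B * - fracint d (horner Q) t).
  apply: weighted_lboundZ => //.
  apply: (@weighted_lbound_powR _ (m%:R + d)
    ((\sum_(i < m.+1) `|Q`_i|) * fracint d (fun=> 1) 1) 0).
    by rewrite /e; lra.
  move=> t _ t1; rewrite lerN2; have t0 : 0 < t by lra.
  apply: (le_trans (ler_norm _)).
  have := normr_fracint_le d0 (ltW t0) (@continuous_horner R Q) (horner_le sQ t1).
  have tn : t != 0 by rewrite gt_eqF.
  move=> /le_trans; apply; rewrite powRD ?tn ?implybT// powR_mulrn ?(ltW t0)//.
  by rewrite le_eqVlt; apply/orP; left; apply/eqP; ring.
have lbF : weighted_lbound e (fracint a (fun t => - F t)).
  apply: (weighted_lbound_fracint (T := T)) => //; try by rewrite /e; lra.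
    by move=> t; apply: cvgN; exact: cF.
  by move=> t Tt; rewrite oppr_ge0 F0.
have [C [T' H]] := weighted_lboundD (weighted_lboundD (weighted_lboundD lbX lbP)
  (weighted_lboundD lbJX lbJQ)) lbF.
exists C, (Num.max T' 1) => t; rewrite ge_max => /andP[/H + t1].
rewrite fracintN// GE ?(lt_le_trans ltr01)//.
by rewrite !mulrBr !mulrN.
Qed.

End Growth.

(** * Oscillation *)

Section Assembly.
Context {R : realType}.
Implicit Types (a b c e t : R) (f g h x : R -> R).

Lemma continuous_extension0 h : {within `]0, +oo[, continuous h} ->
  cvg (h t @[t --> 0^'+]) ->
  exists2 k : R -> R, continuous k & forall t, 0 < t -> k t = h t.
Proof.
move=> ch ch0; pose l := lim (h t @[t --> 0^'+]).
pose h0 t := if 0 < t then h t else l.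
exists (fun t => h0 (Num.max 0 t)); last first.
  by move=> t t0; rewrite max_r ?ltW// /h0 t0.
apply: continuous_ext_max0; apply/continuous_within_itvcyP; split.
  move=> t tpos; have t0 : 0 < t by move: tpos; rewrite in_itv/= andbT.
  have ct : {for t, continuous h}.
    move: ch; rewrite continuous_open_subspace; last exact: interval_open.
    by apply; rewrite inE.
  rewrite /continuous_at {2}/h0 t0; apply: cvg_trans ct.
  apply: near_eq_cvg; near=> s; rewrite /h0 ifT//.
  by near: s; exact: lt_nbhsr.
rewrite {2}/h0 ltxx; apply: cvg_trans ch0.
apply: near_eq_cvg; near=> s; rewrite /h0 ifT//.
Unshelve. all: by end_near. Qed.

Lemma continuous_superposition (f : R -> R -> R) x :
  {within [set p : R * R | 0 <= p.1], continuous (fun p : R * R => f p.1 p.2)} ->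
  {within `[0, +oo[, continuous x} ->
  continuous (fun t => f (Num.max 0 t) (x (Num.max 0 t))).
Proof.
move=> /subspace_continuousP cf /continuous_ext_max0 cx t.
have max0 s : 0 <= Num.max 0 s :> R by rewrite le_max lexx.
have := cf (Num.max 0 t, x (Num.max 0 t)) (max0 t).
apply: cvg_trans; apply: (@cvg_comp _ _ _ (fun s => (Num.max 0 s, x (Num.max 0 s)))
  (fun p : R * R => f p.1 p.2)) => //.
move=> A; rewrite /within /= => HA.
have cm : {for t, continuous (fun s : R => Num.max 0 s)}.
  by apply: continuous_max; [exact: cst_continuous|exact: cvg_id].
have H : nbhs t (fun s => 0 <= Num.max 0 s -> A (f (Num.max 0 s) (x (Num.max 0 s)))).
  exact: cvg_pair cm (cx t) _ HA.
by apply: filterS H => s; apply; exact: max0.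
Qed.

(** The zeros of [x] are bounded, for otherwise they would provide a sequence
    tending to [+oo]; after the last one the intermediate value theorem fixes the
    sign. *)
Lemma nonoscillatory_sign x : {within `[0, +oo[, continuous x} -> ~ oscillatory x ->
  exists2 T, 0 <= T & (forall t, T <= t -> 0 < x t) \/ (forall t, T <= t -> x t < 0).
Proof.
move=> cx nosc.
have [T T0 xT] : exists2 T, 0 <= T & forall t, T <= t -> x t != 0.
  apply: contrapT => H; apply: nosc.
  have zero (k : nat) : exists t, k%:R <= t /\ x t = 0.
    apply: contrapT => Hk; apply: H; exists k%:R => // t kt; apply/eqP => xt.
    by apply: Hk; exists t.
  have [u Hu] := choice zero; exists u; split => [k||k].
  - by have [+ _] := Hu k; apply: le_trans.
  - apply/cvgryPge => A; near=> k; have [+ _] := Hu k; apply: le_trans.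
    by near: k; exact: nbhs_infty_ger.
  - by have [] := Hu k.
exists T => //.
have sgn s t : T <= s -> T <= t -> 0 < x s -> ~ x t < 0.
  move=> Ts Tt xs xt.
  pose p := Num.min s t; pose q := Num.max s t.
  have Tp : T <= p by rewrite le_min Ts.
  have pq : p <= q by rewrite /p /q ge_min !le_max lexx.
  have cxpq : {within `[p, q], continuous x}.
    apply: continuous_subspaceW cx => r; rewrite /= !in_itv/= andbT => /andP[pr _].
    by rewrite (le_trans T0)// (le_trans Tp).
  have bounds : Num.min (x p) (x q) <= 0 <= Num.max (x p) (x q).
    rewrite /p /q; case: (ltgtP s t) => [st|ts|E] /=.
    - by rewrite ge_min (ltW xt) orbT le_max (ltW xs).
    - by rewrite ge_min (ltW xt) le_max (ltW xs) orbT.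
    - by move: xt; rewrite -E ltNge ltW.
  have [c + xc] := IVT pq cxpq bounds.
  rewrite in_itv/= => /andP[pc _].
  by have := xT c (le_trans Tp pc); rewrite xc eqxx.
have := xT T (lexx T); rewrite neq_lt => /orP[xn|xp]; [right|left] => t Tt.
  have := xT t Tt; rewrite neq_lt => /orP[//|xt].
  by case: (sgn t T Tt (lexx T) xt xn).
have := xT t Tt; rewrite neq_lt => /orP[xt|//].
by case: (sgn T t (lexx T) Tt xp xt).
Unshelve. all: by end_near. Qed.

(** The equation is known at positive times only, and the point [0] is
    negligible. *)
Lemma eq_fracint_pos a t f g : 0 < a -> continuous f -> continuous g ->
  (forall s, 0 < s -> f s = g s) -> fracint a f t = fracint a g t.
Proof.
move=> a0 cf cg fg.
have int0 k : continuous k ->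
    lebesgue_measure.-integrable `]0, t] (EFin \o (fun s => ker a (t - s) * k s)).
  move=> ck; apply: integrableS (integrable_ker_sub_mul t a0 ck) => // s.
  by rewrite /= !in_itv/= => /andP[/ltW -> ->].
rewrite /fracint -!Rintegral_itv_obnd_cbnd; [|exact: int0|exact: int0].
by apply: eq_Rintegral => s; rewrite inE/= in_itv/= => /andP[s0 _]; rewrite fg.
Qed.

(** Integrating the equation to the order [a]. If [c != 0] the equation shows that
    the derivative of order [b] has a continuous extension [k], so the inversion
    applies to it, and integrating the result to the order [a - b] gives the
    integral of [k] of order [a]. If [c = 0] there is nothing to invert. *)
Lemma fractional_equation a b c x h F G m : 0 < b -> b < a -> 0 <= c ->
  order_ceil b = m.+1 -> half_C m x -> caputo_exists b x ->
  continuous h -> continuous F -> continuous G ->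
  (forall t, 0 < t -> h t + c * caputo b x t = F t + G t) ->
  exists2 B, 0 <= B & forall t, 0 < t ->
    fracint a G t = fracint a h t
      + B * (fracint (a - b) (fun s => x (Num.max 0 s)) t
             - fracint (a - b) (horner (taylor_poly m.+1 x)) t)
      - fracint a F t.
Proof.
move=> b0 ba c0 bm xC xb ch cF cG eqn.
have a0 : 0 < a by exact: lt_trans ba.
have cN (k : R -> R) : continuous k -> continuous (fun s : R => - k s).
  by move=> ck s; apply: cvgN; exact: ck.
have [cz|cn] := eqVneq c 0.
  exists 0 => // t t0; rewrite mul0r addr0 -fracintN// -fracintD//; last exact: cN.
  apply: eq_fracint_pos => //.
    by move=> s; apply: cvgD; [exact: ch|exact: cN].
  by move=> s /eqn; rewrite cz mul0r addr0 => ->; rewrite addrAC subrr add0r.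
have cp : 0 < c by rewrite lt_neqAle eq_sym cn.
pose k s := c^-1 * (F s + G s - h s).
have ck : continuous k.
  move=> s; apply: cvgM; first exact: cvg_cst.
  by apply: cvgB; [apply: cvgD; [exact: cF|exact: cG]|exact: ch].
have kE t : 0 < t -> caputo b x t = k t.
  by move=> t0; rewrite /k -eqn// addrAC subrr add0r mulKf.
have [c2 c20 inv] := @caputo_inversion R b x k b0 (ltac:(by rewrite bm)) xb ck kE.
have d0 : 0 < a - b by rewrite subr_gt0.
have cX : continuous (fun s : R => x (Num.max 0 s)).
  exact: continuous_ext_max0 (half_C_continuous xC).
have cQ := @continuous_horner R (taylor_poly m.+1 x).
have bt0 := beta_cst_gt0 d0 b0.
exists (c / (c2 * beta_cst (a - b) b)) => [|t t0].
  by rewrite divr_ge0 ?mulr_ge0 ?(ltW bt0)// ltW.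
have cJ : continuous (fracint b k) by exact: continuous_fracint.
have -> : fracint (a - b) (fun s => x (Num.max 0 s)) t -
    fracint (a - b) (horner (taylor_poly m.+1 x)) t = c2 * beta_cst (a - b) b * fracint a k t.
  rewrite -fracintN// -fracintD//; last exact: cN.
  rewrite (@eq_fracint_pos _ _ _ (fun s => c2 * fracint b k s))//.
  - by rewrite fracintZ// fracint_comp// subrK mulrA.
  - by move=> s; apply: cvgD; [exact: cX|exact: cN].
  - by move=> s; apply: cvgM; [exact: cvg_cst|exact: cJ].
  - by move=> s s0; rewrite max_r ?(ltW s0)// -taylor_remainderE -bm inv.
rewrite mulrA mulfVK ?mulf_neq0 ?lt0r_neq0//.
rewrite -fracintZ// -fracintD//; last by move=> s; apply: cvgM; [exact: cvg_cst|exact: ck].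
rewrite -fracintN// -fracintD//; last exact: cN.
  by apply: eq_fracint => s _; rewrite /k mulrA divff// mul1r; ring.
move=> s; apply: cvgD; first exact: ch.
by apply: cvgM; [exact: cvg_cst|exact: ck].
Qed.

Lemma weighted_lbound_limf_einf e G : weighted_lbound e G ->
  limf_einf (fun t : R => (t `^ e * G t)%:E) (pinfty_nbhs R) != -oo%E.
Proof.
move=> [C [T H]]; rewrite limf_einfE gt_eqF//.
apply: (@lt_le_trans _ _ (- C)%:E); first exact: ltNyr.
apply: ereal_sup_ge; exists (ereal_inf ((fun t => (t `^ e * G t)%:E) @` [set t | T <= t])).
  exists [set t | T <= t] => //.
  by exists T; split; [exact: num_real|move=> t /ltW].
by apply: le_ereal_inf_tmp => _ [t /= /H Ht <-]; rewrite lee_fin.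
Qed.

Lemma weighted_lbound_limf_esup e G : weighted_lbound e (fun t => - G t) ->
  limf_esup (fun t : R => (t `^ e * G t)%:E) (pinfty_nbhs R) != +oo%E.
Proof.
move=> /weighted_lbound_limf_einf; apply: contra_neq => E.
rewrite (_ : (fun _ => _) = (fun t => - (t `^ e * G t)%:E)%E); last first.
  by apply/funext => t; rewrite mulrN EFinN.
by rewrite limf_einfN E.
Qed.

End Assembly.

Theorem theorem3p1 (R : realType) (alpha beta a : R) (n : nat)
    (f : R -> R -> R) (g : R -> R)
    (beta_gt0 : 0 < beta) (beta_lt_alpha : beta < alpha)
    (ceil_alpha : Num.ceil alpha = n%:Z)
    (a_ge0 : 0 <= a)
    (f_cont : {within [set p : R * R | 0 <= p.1],
                continuous (fun p : R * R => f p.1 p.2)})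
    (g_cont : {within `[0, +oo[, continuous g})
    (f_sign : exists T : R, 0 < T /\
                forall t y : R, T <= t -> y * f t y <= 0)
    (g_limsup :
      limf_esup (fun t : R =>
        (t `^ (beta - alpha - n%:R + 1) *
          (\int[lebesgue_measure]_(s in `[0%R, t])
             ((t - s) `^ (alpha - 1) * g s))%R)%:E) (pinfty_nbhs R) = +oo%E)
    (g_liminf :
      limf_einf (fun t : R =>
        (t `^ (beta - alpha - n%:R + 1) *
          (\int[lebesgue_measure]_(s in `[0%R, t])
             ((t - s) `^ (alpha - 1) * g s))%R)%:E) (pinfty_nbhs R) = -oo%E)
    (xi : 'I_n -> R) (x : R -> R) :
  global_solution alpha beta a f g xi x -> oscillatory x.
Proof.
move=> [[xC xa ca ca0] xb xeq _]; apply: contrapT => nosc.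
have alpha_gt0 : 0 < alpha by exact: lt_trans beta_lt_alpha.
have cx := half_C_continuous xC.
have [k [ak /andP[_ alpha_le]]] := order_ceilP alpha_gt0.
have [m [bm /andP[mb _]]] := order_ceilP beta_gt0.
have nk : n = k.+1 by rewrite -ak /order_ceil ceil_alpha.
have mk : (m <= k)%N.
  by rewrite -ltnS -(ltr_nat R); apply: lt_le_trans alpha_le; exact: lt_trans beta_lt_alpha.
rewrite ak /= in xC.
pose G t := g (Num.max 0 t); have cG : continuous G by exact: continuous_ext_max0.
pose X t := x (Num.max 0 t); have cX : continuous X by exact: continuous_ext_max0.
pose F t := f (Num.max 0 t) (x (Num.max 0 t)).
have cF : continuous F by exact: (continuous_superposition f_cont cx).
have [h ch hE] := continuous_extension0 ca ca0.
have [A A0 HA] : exists2 A, 0 < A & forall t, 0 < t ->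
    fracint alpha h t = A * (X t - (taylor_poly k.+1 x).[t]).
  have [c c0 E] := @caputo_inversion R alpha x h alpha_gt0
    (ltac:(by rewrite ak)) xa ch (fun t t0 => esym (hE t t0)).
  exists c^-1 => [|t t0]; first by rewrite invr_gt0.
  rewrite /X max_r ?(ltW t0)// -taylor_remainderE -ak E// mulKf//.
  exact: lt0r_neq0.
have [B B0 HB] : exists2 B, 0 <= B & forall t, 0 < t ->
    fracint alpha G t = fracint alpha h t
      + B * (fracint (alpha - beta) X t
             - fracint (alpha - beta) (horner (taylor_poly m.+1 x)) t)
      - fracint alpha F t.
  apply: (fractional_equation beta_gt0 beta_lt_alpha a_ge0 bm (half_CW mk xC) xb) => //.
  by move=> t t0; rewrite hE// xeq// /F /G max_r// ltW.
have idE t : 0 < t -> fracint alpha G t = A * (X t - (taylor_poly k.+1 x).[t])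
    + B * (fracint (alpha - beta) X t - fracint (alpha - beta) (horner (taylor_poly m.+1 x)) t)
    - fracint alpha F t.
  by move=> t0; rewrite HB// HA.
have eE : beta - alpha - n%:R + 1 = - (alpha - beta) - k.+1%:R + 1.
  by rewrite nk opprB.
have wE : (fun t : R => (t `^ (beta - alpha - n%:R + 1) *
    (\int[lebesgue_measure]_(s in `[0%R, t]) ((t - s) `^ (alpha - 1) * g s))%R)%:E)
    = (fun t : R => (t `^ (- (alpha - beta) - k.+1%:R + 1) * fracint alpha G t)%:E).
  apply/funext => t; rewrite eE -(fracintE _ _ cG); congr (_ * _)%:E.
  apply: eq_Rintegral => s; rewrite inE/= in_itv/= => /andP[s0 _].
  by rewrite /G max_r.
have dab : 0 < alpha - beta < alpha by rewrite subr_gt0 beta_lt_alpha ltrBlDr ltrDl.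
have [T T0 sgn] := nonoscillatory_sign cx nosc.
have [T' [T'0 fs]] := f_sign.
pose T1 := Num.max T T'.
have T10 : 0 <= T1 by rewrite le_max T0.
have T1E t : T1 <= t -> [/\ 0 <= t, T <= t & T' <= t].
  by rewrite ge_max => /andP[? ?]; split => //; exact: le_trans T0 _.
have [sP sQ] : (size (taylor_poly k.+1 x) <= k.+1)%N /\
  (size (taylor_poly m.+1 x) <= m.+1)%N by split; exact: size_poly.
case: sgn => sgn.
- have := g_liminf; rewrite wE => /eqP; apply/negP.
  apply: weighted_lbound_limf_einf.
  apply: (weighted_lbound_solution dab alpha_le mk (ltW A0) B0 sP sQ cX cF T10 _ _ idE).
  + by move=> t /T1E[t0 Tt _]; rewrite /X max_r// ltW// sgn.
  + move=> t /T1E[t0 Tt T't]; rewrite /F max_r//.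
    by have := fs t (x t) T't; rewrite pmulr_rle0// sgn.
- have := g_limsup; rewrite wE => /eqP; apply/negP.
  apply: weighted_lbound_limf_esup.
  have cNX : continuous (fun t => - X t) by move=> t; apply: cvgN; exact: cX.
  have cNF : continuous (fun t => - F t) by move=> t; apply: cvgN; exact: cF.
  have [sNP sNQ] : (size (- taylor_poly k.+1 x) <= k.+1)%N /\
    (size (- taylor_poly m.+1 x) <= m.+1)%N by rewrite !size_polyN.
  apply: (weighted_lbound_solution dab alpha_le mk (ltW A0) B0 sNP sNQ cNX cNF T10).
  + by move=> t /T1E[t0 Tt _]; rewrite oppr_ge0 /X max_r// ltW// sgn.
  + move=> t /T1E[t0 Tt T't]; rewrite oppr_le0 /F max_r//.
    by have := fs t (x t) T't; rewrite nmulr_rle0// sgn.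
  + move=> t t0; rewrite idE//.
    have -> : horner (- taylor_poly m.+1 x) = fun s => - (taylor_poly m.+1 x).[s].
      by apply/funext => s; rewrite hornerN.
    have d0 : 0 < alpha - beta by case/andP: dab.
    rewrite !fracintN//; last exact: continuous_horner.
    by rewrite hornerN; ring.
Qed.
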